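(* Let $K>0$ and let $M\in\mathcal{M}^{+}(\Delta_s,\mathcal{C}_K)$. Then there exist $f_1,f_2\in\mathcal{H}^{+}_{\rm cyc}(\mathcal{C}_K)$ such that $M$ can be uniquely expressed as $$M=f_1B_1+f_2B_2 ,$$ (i.e. the pair $(f_1,f_2)$ exists and is unique), where $B_1(w,z)=w+z+\frac1w+\frac1z+2$ and $B_2(w,z)=2wz+\frac{2}{wz}+\frac wz+\frac zw$.
   Context: For $K>0$ the cyclic invariant annulus is $\mathcal{C}_K=\{(w,z)\in\mathbb{C}^2 : e^{-K}<s<e^{K}\text{ for } s=|w|,|z|,|wz|\}$. It is closed under the cyclic transformation $(w,z)\mapsto(z,\frac1{wz})$ and under $(w,z)\mapsto(z,w)$. $\mathcal{H}^{+}(\mathcal{C}_K)$ is the set of holomorphic functions $f$ on $\mathcal{C}_K$ with $f(w,z)=f(z,w)$. $\mathcal{H}^{+}_{\rm cyc}(\mathcal{C}_K)$ is the set of $f\in\mathcal{H}^{+}(\mathcal{C}_K)$ that are cyclic invariant, i.e. $f(w,z)=f(z,\frac1{wz})$ on $\mathcal{C}_K$. The naive symmetric difference operator is $\Delta_s(w)=\frac12\left(w-\frac1w\right)$. A function $M$ on $\mathcal{C}_K$ satisfies the (2-body) cyclic Leibniz rule (CLR) with $\Delta$ if $$M(w,z)\,\Delta\!\left(\tfrac1{wz}\right)+M\!\left(z,\tfrac1{wz}\right)\Delta(w)+M\!\left(\tfrac1{wz},w\right)\Delta(z)=0\quad\text{for all }(w,z)\in\mathcal{C}_K .$$ $\mathcal{M}^{+}(\Delta_s,\mathcal{C}_K)$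 is the set of all $M\in\mathcal{H}^{+}(\mathcal{C}_K)$ that satisfy the CLR with $\Delta_s$ (no normalization of $M$ is imposed). *)

(* Defs.v *)
From Stdlib Require Import Reals.
From Coquelicot Require Import Coquelicot.

(* A function on the domain D is represented by a total function C * C -> C
   whose values outside D are irrelevant; two such functions are identified
   when they agree on D, see [eq_on]. *)
Definition eq_on (D : C * C -> Prop) (f g : C * C -> C) : Prop :=
  forall p : C * C, D p -> f p = g p.

(* [K := C_AbsRing] makes this complex (not merely real) Frechet
   differentiability in both variables jointly, at every point of D.
   It only depends on the values of f on D when D is open. *)
Definition holomorphic_on (D : C * C -> Prop) (f : C * C -> C) : Prop :=
  forall p : C * C, D p -> ex_filterdiff (K := C_AbsRing) f (locally p).

Definition cyclic_annulus (K : R) (p : C * C) : Prop :=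
  let (w, z) := p in
  (exp (- K) < Cmod w < exp K)%R /\
  (exp (- K) < Cmod z < exp K)%R /\
  (exp (- K) < Cmod (w * z)%C < exp K)%R.

Open Scope C_scope.

Definition H_plus (K : R) (f : C * C -> C) : Prop :=
  holomorphic_on (cyclic_annulus K) f /\
  forall w z : C, cyclic_annulus K (w, z) -> f (w, z) = f (z, w).

Definition H_plus_cyc (K : R) (f : C * C -> C) : Prop :=
  H_plus K f /\
  forall w z : C, cyclic_annulus K (w, z) -> f (w, z) = f (z, / (w * z)).

Definition Delta_s (w : C) : C := / 2 * (w - / w).

Definition CLR (Delta : C -> C) (K : R) (M : C * C -> C) : Prop :=
  forall w z : C, cyclic_annulus K (w, z) ->
    M (w, z) * Delta (/ (w * z)) + M (z, / (w * z)) * Delta w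
      + M (/ (w * z), w) * Delta z = 0.

Definition M_plus (Delta : C -> C) (K : R) (M : C * C -> C) : Prop :=
  H_plus K M /\ CLR Delta K M.

Definition basis_B1 (p : C * C) : C :=
  let (w, z) := p in w + z + / w + / z + 2.

Definition basis_B2 (p : C * C) : C :=
  let (w, z) := p in 2 * (w * z) + 2 / (w * z) + w / z + z / w.

(* Main.v *)
Require Import Defs.
From Stdlib Require Import Reals Lra List.
From Coquelicot Require Import Coquelicot.
Open Scope C_scope.

(** Write a = w, b = z, c = 1/(wz). The CLR says that the vector
    (M(a,b), M(b,c), M(c,a)) is orthogonal to (Delta c, Delta a, Delta b), and so are
    the vectors of B1 and B2. Hence the cross product of the vectors of two solutions is
    G * (Delta c, Delta a, Delta b). Its entry with Delta b vanishes at b = 1 and b = -1,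
    so G is holomorphic; it is cyclic invariant and antisymmetric, hence vanishes on
    a = b, b = c and c = a and is divisible by V = (a - b)(b - c)(c - a), with a cyclic
    invariant symmetric quotient. For B1 and B2 the quotient is the constant 2, and
    Cramer's rule gives f1 and f2 as half the quotients of (M, B2) and (B1, M).
    All divisors are graphs x -> phi x, and holomorphy of F / (y - phi x) across the graph
    follows from Cauchy's formula in y, where the kernel 1 / (t (t - y)) of F / y
    remains regular at y = 0. *)

(** Cramer's rule expresses M through B1 and B2 with meromorphic coefficients; the content is that
    they have no poles where the vectors of B1 and B2 become dependent. This holds because the cross
    product of any two symmetric solutions vanishes there too, and that of B1 and B2 vanishes to the
    lowest order possible. Two arguments recur. A vanishing statement is often visible only away
    from finitely many points of a graph: at b = 1 or b = -1 the relation Delta c * N(a,b) = Delta b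
    * N(b,c) gives N = 0 only if Delta c is not zero, and after division by one factor of V nothing
    is known where that factor meets the next one. Continuity along the graph supplies the missing
    points. Conversely, symmetry, cyclic invariance and uniqueness of quotients are proved by
    multiplying with the divisor and cancelling it again, which is possible because a graph has
    empty interior. *)

Lemma locally_Cmod (z : C) (P : C -> Prop) :
  locally (T := C_UniformSpace) z P <->
  exists d : posreal, forall w : C, (Cmod (w - z) < d)%R -> P w.
Proof.
rewrite locally_C. split; intros [d Hd]; exists d; intros w Hw; apply Hd; exact Hw.
Qed.

(** * Continuity of complex-valued functions *)

Section Continuity.
Context {U : UniformSpace}.
Implicit Types (f g : U -> C) (p : U).

Lemma continuous_Cmod f p :
  continuous (U := C_UniformSpace) f p <->
  forall e : posreal, locally p (fun u => (Cmod (f u - f p) < e)%R).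
Proof.
split.
- intros H e. apply (H (fun w => Cmod (w - f p) < e)%R).
  apply locally_Cmod. exists e. auto.
- intros H P HP. apply locally_Cmod in HP. destruct HP as [d Hd].
  exact (filter_imp _ _ (fun u => Hd (f u)) (H d)).
Qed.

Lemma continuous_Cplus f g p :
  continuous (U := C_UniformSpace) f p -> continuous (U := C_UniformSpace) g p ->
  continuous (U := C_UniformSpace) (fun u => f u + g u) p.
Proof. apply (continuous_plus (V := C_NormedModule)). Qed.

Lemma continuous_Copp f p :
  continuous (U := C_UniformSpace) f p ->
  continuous (U := C_UniformSpace) (fun u => - f u) p.
Proof. apply (continuous_opp (V := C_NormedModule)). Qed.

Lemma continuous_Cminus f g p :
  continuous (U := C_UniformSpace) f p -> continuous (U := C_UniformSpace) g p ->
  continuous (U := C_UniformSpace) (fun u => f u - g u) p.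
Proof. apply (continuous_minus (V := C_NormedModule)). Qed.

Lemma continuous_Cmult f g p :
  continuous (U := C_UniformSpace) f p -> continuous (U := C_UniformSpace) g p ->
  continuous (U := C_UniformSpace) (fun u => f u * g u) p.
Proof.
intros Hf Hg.
(* [C_UniformSpace] has the product balls of R * R, [C_AbsRing] those of the modulus; by [locally_C]
   both give the same neighbourhoods. *)
assert (E : forall h : U -> C, continuous (U := C_UniformSpace) h p <->
  continuous (U := AbsRing_UniformSpace C_AbsRing) h p).
{ intros h; split; intros H P HP; apply H; apply locally_C; exact HP. }
apply E. apply (continuous_mult (K := C_AbsRing)); apply E; assumption.
Qed.

Lemma continuous_Cinv f p :
  continuous (U := C_UniformSpace) f p -> f p <> 0 ->
  continuous (U := C_UniformSpace) (fun u => / f u) p.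
Proof.
intros Hf H0. apply continuous_Cmod. intros e.
rewrite continuous_Cmod in Hf.
assert (m0 := proj1 (Cmod_gt_0 _) H0). set (m := Cmod (f p)) in *.
(* The first radius forces |f u| > m / 2; the second then bounds |f u - f p| / (|f u| m) by [e]. *)
assert (d1 : (0 < m / 2)%R) by lra.
assert (d2 : (0 < e * (m * m / 2))%R).
{ apply Rmult_lt_0_compat; [apply e|]. nra. }
generalize (filter_and _ _ (Hf (mkposreal _ d1)) (Hf (mkposreal _ d2))).
apply filter_imp. simpl. intros u [H1 H2].
assert (Hm : (m / 2 < Cmod (f u))%R).
{ assert (T := Cmod_triangle (f u) (- (f u - f p))).
  rewrite Cmod_opp in T. replace (f u + - (f u - f p)) with (f p) in T by ring.
  fold m in T. lra. }
assert (Hu : f u <> 0) by (apply Cmod_gt_0; lra).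
replace (/ f u - / f p) with (- (f u - f p) * / (f u * f p)) by (field; auto).
rewrite Cmod_mult, Cmod_opp, Cmod_inv, Cmod_mult by (apply Cmult_neq_0; auto).
fold m. apply (Rmult_lt_reg_r (Cmod (f u) * m)). nra.
rewrite Rmult_assoc, Rinv_l, Rmult_1_r by nra.
eapply Rlt_le_trans. exact H2.
apply Rmult_le_compat_l. apply Rlt_le, e. nra.
Qed.

Lemma continuous_Cdiv f g p :
  continuous (U := C_UniformSpace) f p -> continuous (U := C_UniformSpace) g p ->
  g p <> 0 -> continuous (U := C_UniformSpace) (fun u => f u / g u) p.
Proof.
intros Hf Hg H0. apply continuous_Cmult; auto. apply continuous_Cinv; auto.
Qed.

Lemma continuous_neq f p (c : C) :
  continuous (U := C_UniformSpace) f p -> f p <> c -> locally p (fun u => f u <> c).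
Proof.
intros Hf H0. rewrite continuous_Cmod in Hf.
assert (m0 : (0 < Cmod (c - f p))%R).
{ apply Cmod_gt_0. intros E. apply H0. replace c with (c - f p + f p) by ring.
  rewrite E. ring. }
generalize (Hf (mkposreal _ m0)). apply filter_imp. simpl. intros u Hu E.
rewrite E in Hu. lra.
Qed.

End Continuity.

(** * Complex differentiability *)

(* Caratheodory's form of differentiability: it turns the calculus rules into
   algebraic identities between the continuous quotients [q]. *)
Definition cdiff (f : C -> C) (z : C) : Prop :=
  exists q : C -> C, continuous (T := C_UniformSpace) (U := C_UniformSpace) q z /\
    forall w, f w = f z + q w * (w - z).

Definition C2 := prod_UniformSpace C_UniformSpace C_UniformSpace.

(** [A] and [B] are not determined by [F]: a term can be moved from one to the other. Only their
    values at [p], the partial derivatives, are intrinsic. *)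
Definition cdiff2 (F : C * C -> C) (p : C * C) : Prop :=
  exists A B : C * C -> C,
    continuous (T := C2) (U := C_UniformSpace) A p /\
    continuous (T := C2) (U := C_UniformSpace) B p /\
    forall u, F u = F p + A u * (fst u - fst p) + B u * (snd u - snd p).

Lemma continuous_fst2 (p : C2) : continuous (T := C2) (U := C_UniformSpace) fst p.
Proof. apply (continuous_fst (U:=C_UniformSpace) (V:=C_UniformSpace)). Qed.
Lemma continuous_snd2 (p : C2) : continuous (T := C2) (U := C_UniformSpace) snd p.
Proof. apply (continuous_snd (U:=C_UniformSpace) (V:=C_UniformSpace)). Qed.

Lemma continuous_idC (p : C) : continuous (T := C_UniformSpace) (U := C_UniformSpace) (fun w => w) p.
Proof. apply continuous_id. Qed.

(** The cases [Cmult ?c] and [Cplus ?c] catch functions that appear eta-reduced. Quotients are left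
    to the caller, since they need a non-vanishing denominator. *)
Ltac ccont := repeat lazymatch goal with
  | |- continuous (fun _ => ?c) _ => apply continuous_const
  | |- continuous (fun u => u) _ => apply continuous_idC
  | |- continuous (Cmult ?c) _ => apply (continuous_Cmult (fun _ => c) (fun w => w))
  | |- continuous (Cplus ?c) _ => apply (continuous_Cplus (fun _ => c) (fun w => w))
  | |- continuous fst _ => apply continuous_fst2
  | |- continuous snd _ => apply continuous_snd2
  | |- continuous (fun u => fst u) _ => apply continuous_fst2
  | |- continuous (fun u => snd u) _ => apply continuous_snd2
  | |- continuous (fun u => _ + _) _ => apply continuous_Cplus
  | |- continuous (fun u => _ - _) _ => apply continuous_Cminus
  | |- continuous (fun u => - _) _ => apply continuous_Copp
  | |- continuous (fun u => _ * _) _ => apply continuous_Cmult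
  | |- continuous _ _ => assumption
  end.

Lemma cdiff_continuous f z :
  cdiff f z -> continuous (T := C_UniformSpace) (U := C_UniformSpace) f z.
Proof.
intros [q [Hq E]]. apply continuous_ext with (fun w => f z + q w * (w - z)).
intros; symmetry; apply E. ccont.
Qed.

Lemma cdiff2_continuous (F : C * C -> C) (p : C * C) :
  cdiff2 F p -> continuous (T := C2) (U := C_UniformSpace) F p.
Proof.
intros (A & B & HA & HB & E).
apply continuous_ext with (fun u => F p + A u * (fst u - fst p) + B u * (snd u - snd p)).
intros; symmetry; apply E. ccont.
Qed.

Lemma cdiff_const c z : cdiff (fun _ => c) z.
Proof. exists (fun _ => 0). split. ccont. intros; ring. Qed.

Lemma cdiff_id z : cdiff (fun w => w) z.
Proof. exists (fun _ => 1). split. ccont. intros; ring. Qed.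

Lemma cdiff_minus f g z : cdiff f z -> cdiff g z -> cdiff (fun w => f w - g w) z.
Proof.
intros [q [Hq E]] [k [Hk K]]. exists (fun w => q w - k w). split. ccont.
intros w. rewrite (E w), (K w). ring.
Qed.

Lemma cdiff_mult f g z : cdiff f z -> cdiff g z -> cdiff (fun w => f w * g w) z.
Proof.
intros Hf [k [Hk K]]. assert (Cf := cdiff_continuous _ _ Hf).
destruct Hf as [q [Hq E]].
exists (fun w => q w * g z + f w * k w). split. ccont.
intros w. rewrite (K w), (E w). ring.
Qed.

Lemma cdiff_inv f z : cdiff f z -> f z <> 0 -> cdiff (fun w => / f w) z.
Proof.
intros Hf H0. assert (Cf := cdiff_continuous _ _ Hf).
destruct Hf as [q [Hq E]].
(* The quotient has to be a global identity, so it is corrected where [f] vanishes. *)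
exists (fun w => if Req_EM_T (Cmod (f w)) 0 then (/ f w - / f z) / (w - z)
                 else - q w * / (f w * f z)). split.
- apply (continuous_ext_loc _ (fun w => - q w * / (f w * f z))).
  + generalize (continuous_neq _ _ 0 Cf H0). apply filter_imp. intros w Hw.
    destruct (Req_EM_T _ _) as [e|]; auto. apply Cmod_eq_0 in e. contradiction.
  + apply continuous_Cmult. ccont. apply continuous_Cinv. ccont. apply Cmult_neq_0; auto.
- intros w. destruct (Req_EM_T _ _) as [e|e].
  + apply Cmod_eq_0 in e. assert (w - z <> 0).
    { intros W. apply H0. rewrite <- e. replace w with (w - z + z) by ring. rewrite W. f_equal. ring. }
    generalize (/ f w). intros v. field. auto.
  + assert (f w <> 0). { intros W. apply e. rewrite W. apply Cmod_0. }
    replace (q w) with (q w * 1) by ring.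
    replace (/ f w) with (/ f z - (f w - f z) / (f w * f z)) by (field; auto).
    replace (f w - f z) with (q w * (w - z)) by (rewrite (E w); ring).
    field. auto.
Qed.

Lemma cdiff2_const c p : cdiff2 (fun _ => c) p.
Proof. exists (fun _ => 0), (fun _ => 0). split. ccont. split. ccont. intros; ring. Qed.

Lemma cdiff2_fst p : cdiff2 fst p.
Proof. exists (fun _ => 1), (fun _ => 0). split. ccont. split. ccont. intros; ring. Qed.

Lemma cdiff2_snd p : cdiff2 snd p.
Proof. exists (fun _ => 0), (fun _ => 1). split. ccont. split. ccont. intros; ring. Qed.

Lemma cdiff2_comp1 f F p : cdiff f (F p) -> cdiff2 F p -> cdiff2 (fun u => f (F u)) p.
Proof.
intros [q [Hq E]] HF. assert (CF := cdiff2_continuous _ _ HF).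
destruct HF as (A & B & HA & HB & K).
assert (Cq : continuous (T := C2) (U := C_UniformSpace) (fun u => q (F u)) p)
  by (apply continuous_comp; auto).
exists (fun u => q (F u) * A u), (fun u => q (F u) * B u). split. ccont. split. ccont.
intros u. rewrite (E (F u)). rewrite (K u) at 2. ring.
Qed.

Lemma cdiff2_comp2 H F G p : cdiff2 H (F p, G p) -> cdiff2 F p -> cdiff2 G p ->
  cdiff2 (fun u => H (F u, G u)) p.
Proof.
intros (A & B & HA & HB & K) HF HG.
assert (CF := cdiff2_continuous _ _ HF). assert (CG := cdiff2_continuous _ _ HG).
destruct HF as (A1 & B1 & HA1 & HB1 & K1). destruct HG as (A2 & B2 & HA2 & HB2 & K2).
assert (Cc : forall h : C * C -> C, continuous (T := C2) (U := C_UniformSpace) h (F p, G p) ->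
   continuous (T := C2) (U := C_UniformSpace) (fun u => h (F u, G u)) p).
{ intros h Hh. 
  apply (continuous_comp_2 (U:=C2) (V:=C_UniformSpace) (W:=C_UniformSpace) (X:=C_UniformSpace) F G (fun x y => h (x,y))); auto.
  eapply continuous_ext. 2: exact Hh. intros [x y]; reflexivity. }
exists (fun u => A (F u, G u) * A1 u + B (F u, G u) * A2 u),
       (fun u => A (F u, G u) * B1 u + B (F u, G u) * B2 u).
split. ccont; apply Cc; auto. split. ccont; apply Cc; auto.
intros u. rewrite (K (F u, G u)). simpl. rewrite (K1 u) at 2. rewrite (K2 u) at 3. ring.
Qed.

Lemma cdiff2_plus F G p : cdiff2 F p -> cdiff2 G p -> cdiff2 (fun u => F u + G u) p.
Proof.
intros (A1 & B1 & HA1 & HB1 & K1) (A2 & B2 & HA2 & HB2 & K2).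
exists (fun u => A1 u + A2 u), (fun u => B1 u + B2 u). split. ccont. split. ccont.
intros u. rewrite (K1 u), (K2 u). ring.
Qed.

Lemma cdiff2_opp F p : cdiff2 F p -> cdiff2 (fun u => - F u) p.
Proof.
intros (A1 & B1 & HA1 & HB1 & K1).
exists (fun u => - A1 u), (fun u => - B1 u). split. ccont. split. ccont.
intros u. rewrite (K1 u). ring.
Qed.

Lemma cdiff2_minus F G p : cdiff2 F p -> cdiff2 G p -> cdiff2 (fun u => F u - G u) p.
Proof. intros; apply cdiff2_plus; auto; apply cdiff2_opp; auto. Qed.

Lemma cdiff2_mult F G p : cdiff2 F p -> cdiff2 G p -> cdiff2 (fun u => F u * G u) p.
Proof.
intros HF (A2 & B2 & HA2 & HB2 & K2). assert (CF := cdiff2_continuous _ _ HF).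
destruct HF as (A1 & B1 & HA1 & HB1 & K1).
exists (fun u => A1 u * G p + F u * A2 u), (fun u => B1 u * G p + F u * B2 u).
split. ccont. split. ccont.
intros u. rewrite (K2 u), (K1 u). ring.
Qed.

Lemma cdiff2_inv F p : cdiff2 F p -> F p <> 0 -> cdiff2 (fun u => / F u) p.
Proof.
intros HF H0. apply (cdiff2_comp1 (fun w => / w)); auto. apply cdiff_inv; auto. apply cdiff_id.
Qed.

Lemma cdiff2_div F G p : cdiff2 F p -> cdiff2 G p -> G p <> 0 -> cdiff2 (fun u => F u / G u) p.
Proof. intros; apply cdiff2_mult; auto; apply cdiff2_inv; auto. Qed.

Lemma cdiff2_slice1 F x y : cdiff2 F (x, y) -> cdiff (fun t => F (t, y)) x.
Proof.
intros (A & B & HA & HB & K). exists (fun t => A (t, y)). split.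
- apply (continuous_comp_2 (U:=C_UniformSpace) (V:=C_UniformSpace) (W:=C_UniformSpace) (X:=C_UniformSpace) (fun t => t) (fun _ => y) (fun x y => A (x,y))).
  ccont. ccont. eapply continuous_ext. 2: exact HA. intros [? ?]; reflexivity.
- intros w. rewrite (K (w, y)). simpl. ring.
Qed.

Lemma cdiff2_slice2 F x y : cdiff2 F (x, y) -> cdiff (fun t => F (x, t)) y.
Proof.
intros (A & B & HA & HB & K). exists (fun t => B (x, t)). split.
- apply (continuous_comp_2 (U:=C_UniformSpace) (V:=C_UniformSpace) (W:=C_UniformSpace) (X:=C_UniformSpace) (fun _ => x) (fun t => t) (fun x y => B (x,y))).
  ccont. ccont. eapply continuous_ext. 2: exact HB. intros [? ?]; reflexivity.
- intros w. rewrite (K (x, w)). simpl. ring.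
Qed.

(** * Comparison with Frechet differentiability in two variables *)

Lemma locally_C2 (p : C * C) (P : C * C -> Prop) :
  locally (T := C2) p P <->
  exists d : posreal, forall x y : C, (Cmod (x - fst p) < d)%R -> (Cmod (y - snd p) < d)%R -> P (x, y).
Proof.
split.
- intros [d Hd].
  destruct (proj1 (locally_Cmod (fst p) (fun x => ball (M:=C_UniformSpace) (fst p) d x)) (locally_ball _ _)) as [d1 H1].
  destruct (proj1 (locally_Cmod (snd p) (fun x => ball (M:=C_UniformSpace) (snd p) d x)) (locally_ball _ _)) as [d2 H2].
  assert (D : (0 < Rmin d1 d2)%R) by (apply Rmin_pos; [apply d1 | apply d2]).
  exists (mkposreal _ D). simpl. intros x y Hx Hy. apply Hd. split; simpl.
  + apply H1. eapply Rlt_le_trans. exact Hx. apply Rmin_l.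
  + apply H2. eapply Rlt_le_trans. exact Hy. apply Rmin_r.
- intros [d Hd].
  destruct (proj2 (locally_Cmod (fst p) (fun x => (Cmod (x - fst p) < d)%R))) as [d1 H1].
  { exists d; auto. }
  destruct (proj2 (locally_Cmod (snd p) (fun x => (Cmod (x - snd p) < d)%R))) as [d2 H2].
  { exists d; auto. }
  assert (D : (0 < Rmin d1 d2)%R) by (apply Rmin_pos; [apply d1 | apply d2]).
  exists (mkposreal _ D). intros [x y] [Hx Hy]. apply Hd.
  + apply H1. eapply ball_le. 2: exact Hx. apply Rmin_l.
  + apply H2. eapply ball_le. 2: exact Hy. apply Rmin_r.
Qed.

Lemma cdiff2_intro (F : C * C -> C) (p : C * C) (a b : C) :
  (forall e : posreal, locally (T := C2) p (fun u : C * C =>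
     (Cmod (F u - F p - a * (fst u - fst p) - b * (snd u - snd p))
      <= e * (Cmod (fst u - fst p) + Cmod (snd u - snd p)))%R)) -> cdiff2 F p.
Proof.
intros H.
set (rem := fun u : C * C => F u - F p - a * (fst u - fst p) - b * (snd u - snd p)).
(* The remainder is put on the increment of larger modulus. *)
set (big := fun u : C * C => Rle_dec (Cmod (snd u - snd p)) (Cmod (fst u - fst p))).
assert (small : forall e : posreal, locally (T := C2) p (fun u : C * C =>
     (Cmod (if big u then rem u / (fst u - fst p) else rem u / (snd u - snd p)) < e)%R)).
(* The sum of both increments is at most twice the larger one, so e / 3 leaves the strict bound 2 e
   / 3 < e. *)
{ intros e. assert (e3 : (0 < e / 3)%R) by (generalize (cond_pos e); lra).
  generalize (H (mkposreal _ e3)). apply filter_imp. simpl. intros u Hu. fold (rem u) in Hu.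
  assert (He := cond_pos e). destruct (big u) as [L|L].
  - destruct (Req_EM_T (Cmod (fst u - fst p)) 0) as [Z|Z].
    + apply Cmod_eq_0 in Z. rewrite Z in Hu, L. rewrite Cmod_0 in Hu, L.
      assert (Cmod (rem u) = 0%R). { generalize (Cmod_ge_0 (snd u - snd p)) (Cmod_ge_0 (rem u)). nra. }
      unfold Cdiv. rewrite Cmod_mult, H0. lra.
    + assert (0 < Cmod (fst u - fst p))%R by (generalize (Cmod_ge_0 (fst u - fst p)); lra).
      rewrite Cmod_div by (apply Cmod_gt_0; auto).
      apply (Rmult_lt_reg_r (Cmod (fst u - fst p))); auto. unfold Rdiv at 1. rewrite Rmult_assoc, Rinv_l, Rmult_1_r by lra. nra.
  - assert (0 < Cmod (snd u - snd p))%R by (generalize (Cmod_ge_0 (fst u - fst p)); lra).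
      rewrite Cmod_div by (apply Cmod_gt_0; auto).
      apply (Rmult_lt_reg_r (Cmod (snd u - snd p))); auto. unfold Rdiv at 1. rewrite Rmult_assoc, Rinv_l, Rmult_1_r by lra. nra. }
(* With / 0 = 0 the quotients take at [p] the value 0, which is the limit that continuity asks
   for. *)
assert (inv0 : / (RtoC 0) = 0).
{ unfold Cinv, RtoC; simpl. apply injective_projections; simpl; unfold Rdiv; ring. }
exists (fun u : C * C => a + if big u then rem u / (fst u - fst p) else 0),
       (fun u : C * C => b + if big u then RtoC 0 else rem u / (snd u - snd p)).
split; [|split].
- apply continuous_Cplus. ccont. apply continuous_Cmod. intros e.
  generalize (small e). apply filter_imp. intros u Hu. 
  replace (if big p then rem p / (fst p - fst p) else 0) with (RtoC 0).
  2:{ destruct (big p); auto. replace (fst p - fst p) with (RtoC 0) by ring. unfold Cdiv. rewrite inv0. ring. }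
  unfold Cminus at 1. rewrite Copp_0, Cplus_0_r. destruct (big u); auto. rewrite Cmod_0. apply e.
- apply continuous_Cplus. ccont. apply continuous_Cmod. intros e.
  generalize (small e). apply filter_imp. intros u Hu. 
  replace (if big p then RtoC 0 else rem p / (snd p - snd p)) with (RtoC 0).
  2:{ destruct (big p); auto. replace (snd p - snd p) with (RtoC 0) by ring. unfold Cdiv. rewrite inv0. ring. }
  unfold Cminus at 1. rewrite Copp_0, Cplus_0_r. destruct (big u); auto. rewrite Cmod_0. apply e.
- intros u. transitivity (F p + a * (fst u - fst p) + b * (snd u - snd p) + rem u).
  { unfold rem. ring. }
  destruct (big u) as [L|L].
  + destruct (Req_EM_T (Cmod (fst u - fst p)) 0) as [Z|Z].
    * assert (Z2 : Cmod (snd u - snd p) = 0%R). { generalize (Cmod_ge_0 (snd u - snd p)). lra. }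
      apply Cmod_eq_0 in Z. apply Cmod_eq_0 in Z2.
      assert (rem u = 0).
      { unfold rem. rewrite Z, Z2. replace u with p. ring.
        destruct u as [u1 u2], p as [p1 p2]; simpl in *. f_equal.
        - replace u1 with (u1 - p1 + p1) by ring. rewrite Z. ring.
        - replace u2 with (u2 - p2 + p2) by ring. rewrite Z2. ring. }
      rewrite H0, Z, Z2. ring.
    * field. intros E. apply Z. rewrite E. apply Cmod_0.
  + field. intros E. rewrite E, Cmod_0 in L. apply L. apply Cmod_ge_0.
Qed.

(** A linear map on C * C is given by its values on the two unit vectors, which become [A p] and
    [B p]. The norm on the product is Euclidean: it is at most the sum of the two moduli and at
    least each of them, and each direction uses one of these bounds. *)
Lemma ex_filterdiff_cdiff2 (F : C * C -> C) (p : C * C) :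
  ex_filterdiff (K := C_AbsRing) F (locally p) <-> cdiff2 F p.
Proof.
split.
- intros [l [[lp ls _] Hl]].
  assert (Hp := Hl p (fun P H => H)). clear Hl.
  set (a := l (RtoC 1, RtoC 0)). set (b := l (RtoC 0, RtoC 1)).
  assert (El : forall u : C * C, l u = a * fst u + b * snd u).
  { intros u.
    transitivity (l (plus (scal (fst u : C) (RtoC 1, RtoC 0)) (scal (snd u : C) (RtoC 0, RtoC 1)))).
    - f_equal. destruct u as [u1 u2]. apply injective_projections.
      + change (u1 = u1 * 1 + u2 * 0). ring.
      + change (u2 = u1 * 0 + u2 * 1). ring.
    - rewrite lp, !ls. change (fst u * a + snd u * b = a * fst u + b * snd u). ring. }
  apply (cdiff2_intro F p a b).
  intros e. generalize (Hp e). apply filter_imp. intros u Hu.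
  rewrite El in Hu.
  assert (E : forall x y h k a' b' : C, x - y - a' * h - b' * k = (x - y) - (a' * h + b' * k)) by (intros; ring).
  rewrite E.
  eapply Rle_trans. exact Hu. apply Rmult_le_compat_l. apply Rlt_le, e.
  change (sqrt (Cmod (fst u - fst p) ^ 2 + Cmod (snd u - snd p) ^ 2)
     <= Cmod (fst u - fst p) + Cmod (snd u - snd p))%R.
  generalize (Cmod_ge_0 (fst u - fst p)) (Cmod_ge_0 (snd u - snd p)). intros.
  rewrite <- (sqrt_pow2 (Cmod (fst u - fst p) + Cmod (snd u - snd p))) by lra.
  apply sqrt_le_1_alt. nra.
- intros (A & B & HA & HB & K).
  exists (fun u : C * C => A p * fst u + B p * snd u). 
  assert (N1 : forall u : C * C, (Cmod (fst u) <= norm (K := C_AbsRing) (V := prod_NormedModule _ C_NormedModule C_NormedModule) u)%R).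
  { intros u. unfold norm; simpl. unfold prod_norm. change (norm (fst u)) with (Cmod (fst u)). change (norm (snd u)) with (Cmod (snd u)).
    rewrite <- (sqrt_pow2 (Cmod (fst u))) at 1 by apply Cmod_ge_0. apply sqrt_le_1_alt.
    generalize (pow2_ge_0 (Cmod (snd u))). lra. }
  assert (N2 : forall u : C * C, (Cmod (snd u) <= norm (K := C_AbsRing) (V := prod_NormedModule _ C_NormedModule C_NormedModule) u)%R).
  { intros u. unfold norm; simpl. unfold prod_norm. change (norm (fst u)) with (Cmod (fst u)). change (norm (snd u)) with (Cmod (snd u)).
    rewrite <- (sqrt_pow2 (Cmod (snd u))) at 1 by apply Cmod_ge_0. apply sqrt_le_1_alt.
    generalize (pow2_ge_0 (Cmod (fst u))). lra. }
  split.
  + split.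
    * intros x y. simpl. change plus with Cplus. ring.
    * intros k x. simpl. change scal with Cmult. ring.
    (* A linear map has to come with a strictly positive bound, hence the summand 1. *)
    * exists (Cmod (A p) + Cmod (B p) + 1)%R. split.
      generalize (Cmod_ge_0 (A p)) (Cmod_ge_0 (B p)). lra.
      intros x. eapply Rle_trans. apply Cmod_triangle. rewrite !Cmod_mult.
      assert (aux : forall a b f s n : R, (0 <= a -> 0 <= b -> 0 <= f -> f <= n -> s <= n ->
        a * f + b * s <= (a + b + 1) * n)%R) by (intros; nra).
      apply aux; try apply Cmod_ge_0. apply N1. apply N2.
  + intros x Hx. 
    assert (x = p). { symmetry. apply (is_filter_lim_locally_unique (K := C_AbsRing) (V := prod_NormedModule _ C_NormedModule C_NormedModule)). exact Hx. }
    subst x. intros e.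
    assert (e2 : (0 < e / 2)%R) by (generalize (cond_pos e); lra).
    rewrite continuous_Cmod in HA. rewrite continuous_Cmod in HB.
    generalize (filter_and _ _ (HA (mkposreal _ e2)) (HB (mkposreal _ e2))).
    apply filter_imp. simpl. intros u [H1 H2].
    assert (E : forall v : C * C, (F v - F p) - (A p * (fst v - fst p) + B p * (snd v - snd p))
      = (A v - A p) * (fst v - fst p) + (B v - B p) * (snd v - snd p)) by (intros v; rewrite (K v); ring).
    change (Cmod ((F u - F p) - (A p * (fst u - fst p) + B p * (snd u - snd p)))
      <= e * norm (K := C_AbsRing) (V := prod_NormedModule _ C_NormedModule C_NormedModule) (minus u p))%R.
    rewrite E.
    eapply Rle_trans. apply Cmod_triangle. rewrite !Cmod_mult.
    assert (aux : forall a b f s n : R, (0 <= f -> 0 <= s -> a < e / 2 -> b < e / 2 -> f <= n -> s <= n ->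
        a * f + b * s <= e * n)%R) by (intros; nra).
    apply aux; try apply Cmod_ge_0; auto. apply (N1 (minus u p)). apply (N2 (minus u p)).
Qed.

(** * Goursat's lemma and Cauchy's formula on rectangles *)

Definition CInt (g : R -> C) (a b : R) : C := RInt (V := C_R_CompleteNormedModule) g a b.

Definition Ccont_seg (g : R -> C) (a b : R) : Prop :=
  forall t, (a <= t <= b)%R -> continuous (T := R_UniformSpace) (U := C_UniformSpace) g t.

Lemma Ccont_ex_RInt g a b : (a <= b)%R -> Ccont_seg g a b ->
  ex_RInt (V := C_R_NormedModule) g a b.
Proof.
intros ab Hg. apply (ex_RInt_continuous (V := C_R_CompleteNormedModule)).
intros z. rewrite Rmin_left, Rmax_right by auto. apply Hg.
Qed.

(** [C_R_NormedModule] is a module over the reals, so multiplication by a complex constant is done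
    on real and imaginary parts. *)
Lemma is_RInt_Cmult (c : C) (g : R -> C) a b (l : C) :
  is_RInt (V := C_R_NormedModule) g a b l ->
  is_RInt (V := C_R_NormedModule) (fun t => c * g t) a b (c * l).
Proof.
intros H.
assert (H1 := is_RInt_fct_extend_fst (U := R_NormedModule) (V := R_NormedModule) _ _ _ _ H).
assert (H2 := is_RInt_fct_extend_snd (U := R_NormedModule) (V := R_NormedModule) _ _ _ _ H).
apply (is_RInt_fct_extend_pair (U := R_NormedModule) (V := R_NormedModule)).
- apply (is_RInt_minus (V := R_NormedModule)); apply (is_RInt_scal (V := R_NormedModule)); auto.
- apply (is_RInt_plus (V := R_NormedModule)); apply (is_RInt_scal (V := R_NormedModule)); auto.
Qed.

Lemma CInt_Cmult c g a b : (a <= b)%R -> Ccont_seg g a b ->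
  CInt (fun t => c * g t) a b = c * CInt g a b.
Proof.
intros ab Hg. apply (is_RInt_unique (V := C_R_CompleteNormedModule)).
apply is_RInt_Cmult. apply (RInt_correct (V := C_R_CompleteNormedModule)).
apply Ccont_ex_RInt; auto.
Qed.

Lemma CInt_plus g h a b : (a <= b)%R -> Ccont_seg g a b -> Ccont_seg h a b ->
  CInt (fun t => g t + h t) a b = CInt g a b + CInt h a b.
Proof.
intros ab Hg Hh. apply (RInt_plus (V := C_R_CompleteNormedModule)); apply Ccont_ex_RInt; auto.
Qed.

Lemma CInt_const c a b : CInt (fun _ => c) a b = RtoC (b - a) * c.
Proof.
unfold CInt. rewrite (RInt_const (V := C_R_CompleteNormedModule)).
destruct c as [x y]. apply injective_projections; simpl; change scal with Rmult; simpl; ring.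
Qed.

Lemma CInt_Chasles g a b c : (a <= b)%R -> (b <= c)%R -> Ccont_seg g a c ->
  CInt g a b + CInt g b c = CInt g a c.
Proof.
intros ab bc Hg. apply (RInt_Chasles (V := C_R_CompleteNormedModule));
apply Ccont_ex_RInt; auto; intros t Ht; apply Hg; lra.
Qed.

Lemma CInt_le g a b M : (a <= b)%R -> Ccont_seg g a b ->
  (forall t, (a <= t <= b)%R -> (Cmod (g t) <= M)%R) -> (Cmod (CInt g a b) <= (b - a) * M)%R.
Proof.
intros ab Hg HM. rewrite Cmod_norm.
apply (norm_RInt_le_const (V := C_R_NormedModule) g a b); auto.
intros x Hx. rewrite <- Cmod_norm. auto.
apply (RInt_correct (V := C_R_CompleteNormedModule)). apply Ccont_ex_RInt; auto.
Qed.

Lemma CInt_ext g h a b : (a <= b)%R -> (forall t, (a <= t <= b)%R -> g t = h t) ->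
  CInt g a b = CInt h a b.
Proof.
intros ab H. apply (RInt_ext (V := C_R_CompleteNormedModule)).
rewrite Rmin_left, Rmax_right by auto. intros; apply H; lra.
Qed.

(** * Contour integrals over rectangles *)

Definition rbd (x1 x2 y1 y2 : R) (p : C) : Prop :=
  (x1 <= fst p <= x2)%R /\ (y1 <= snd p <= y2)%R /\
  (fst p = x1 \/ fst p = x2 \/ snd p = y1 \/ snd p = y2).

(* Opposite sides of the contour are grouped, so that only constants have to be
   integrated when [g] is affine. *)
Definition rint (g : C -> C) (x1 x2 y1 y2 : R) : C :=
  CInt (fun t => g (t, y1) - g (t, y2)) x1 x2 +
  Ci * CInt (fun t => g (x2, t) - g (x1, t)) y1 y2.

Definition rcont (g : C -> C) x1 x2 y1 y2 : Prop := forall p, rbd x1 x2 y1 y2 p ->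
  continuous (T := C_UniformSpace) (U := C_UniformSpace) g p.

Lemma continuous_Cpair1 (y t : R) :
  continuous (T := R_UniformSpace) (U := C_UniformSpace) (fun t => (t, y)) t.
Proof.
intros P [e He]. exists e. intros s Hs. apply He. split; simpl; auto. apply ball_center.
Qed.

Lemma continuous_Cpair2 (x t : R) :
  continuous (T := R_UniformSpace) (U := C_UniformSpace) (fun t => (x, t)) t.
Proof.
intros P [e He]. exists e. intros s Hs. apply He. split; simpl; auto. apply ball_center.
Qed.

Lemma rcont_h g x1 x2 y1 y2 y : rcont g x1 x2 y1 y2 -> (y1 <= y2)%R -> y = y1 \/ y = y2 ->
  Ccont_seg (fun t => g (t, y)) x1 x2.
Proof.
intros Hg h Hy t Ht. apply (continuous_comp (U := R_UniformSpace) (V := C_UniformSpace) (W := C_UniformSpace) (fun t => (t, y)) g).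
apply continuous_Cpair1. apply Hg. split; simpl. auto. destruct Hy; subst; split; auto; lra.
Qed.

Lemma rcont_v g x1 x2 y1 y2 x : rcont g x1 x2 y1 y2 -> (x1 <= x2)%R -> x = x1 \/ x = x2 ->
  Ccont_seg (fun t => g (x, t)) y1 y2.
Proof.
intros Hg h Hx t Ht. apply (continuous_comp (U := R_UniformSpace) (V := C_UniformSpace) (W := C_UniformSpace) (fun t => (x, t)) g).
apply continuous_Cpair2. apply Hg. split; simpl; destruct Hx; subst; auto; lra.
Qed.

Lemma rcont_sides g x1 x2 y1 y2 : (x1 <= x2)%R -> (y1 <= y2)%R -> rcont g x1 x2 y1 y2 ->
  Ccont_seg (fun t => g (t, y1)) x1 x2 /\ Ccont_seg (fun t => g (t, y2)) x1 x2 /\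
  Ccont_seg (fun t => g (x1, t)) y1 y2 /\ Ccont_seg (fun t => g (x2, t)) y1 y2.
Proof.
intros hx hy Hg. repeat split.
1, 2: eapply rcont_h; eauto. all: eapply rcont_v; eauto.
Qed.

Lemma Ccont_seg_minus g h a b : Ccont_seg g a b -> Ccont_seg h a b ->
  Ccont_seg (fun t => g t - h t) a b.
Proof. intros Hg Hh t Ht. apply continuous_Cminus; auto. Qed.

Lemma CInt_minus g h a b : (a <= b)%R -> Ccont_seg g a b -> Ccont_seg h a b ->
  CInt (fun t => g t - h t) a b = CInt g a b - CInt h a b.
Proof.
intros ab Hg Hh. apply (RInt_minus (V := C_R_CompleteNormedModule)); apply Ccont_ex_RInt; auto.
Qed.

Lemma rint_sides g x1 x2 y1 y2 : (x1 <= x2)%R -> (y1 <= y2)%R -> rcont g x1 x2 y1 y2 ->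
  rint g x1 x2 y1 y2 =
  CInt (fun t => g (t, y1)) x1 x2 - CInt (fun t => g (t, y2)) x1 x2 +
  Ci * (CInt (fun t => g (x2, t)) y1 y2 - CInt (fun t => g (x1, t)) y1 y2).
Proof.
intros hx hy Hg. destruct (rcont_sides _ _ _ _ _ hx hy Hg) as (? & ? & ? & ?).
unfold rint. rewrite !CInt_minus by assumption. reflexivity.
Qed.

Lemma rcont_plus g h x1 x2 y1 y2 : rcont g x1 x2 y1 y2 -> rcont h x1 x2 y1 y2 ->
  rcont (fun p => g p + h p) x1 x2 y1 y2.
Proof. intros Hg Hh p Hp. apply continuous_Cplus; auto. Qed.

Lemma rcont_Cmult c g x1 x2 y1 y2 : rcont g x1 x2 y1 y2 ->
  rcont (fun p => c * g p) x1 x2 y1 y2.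
Proof. intros Hg p Hp. apply continuous_Cmult; auto. apply continuous_const. Qed.

Lemma rint_plus g h x1 x2 y1 y2 : (x1 <= x2)%R -> (y1 <= y2)%R ->
  rcont g x1 x2 y1 y2 -> rcont h x1 x2 y1 y2 ->
  rint (fun p => g p + h p) x1 x2 y1 y2 = rint g x1 x2 y1 y2 + rint h x1 x2 y1 y2.
Proof.
intros hx hy Hg Hh. rewrite !rint_sides by (auto; apply rcont_plus; auto).
destruct (rcont_sides _ _ _ _ _ hx hy Hg) as (? & ? & ? & ?).
destruct (rcont_sides _ _ _ _ _ hx hy Hh) as (? & ? & ? & ?).
rewrite !CInt_plus by assumption. ring.
Qed.

Lemma rint_Cmult c g x1 x2 y1 y2 : (x1 <= x2)%R -> (y1 <= y2)%R -> rcont g x1 x2 y1 y2 ->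
  rint (fun p => c * g p) x1 x2 y1 y2 = c * rint g x1 x2 y1 y2.
Proof.
intros hx hy Hg. rewrite !rint_sides by (auto; apply rcont_Cmult; auto).
destruct (rcont_sides _ _ _ _ _ hx hy Hg) as (? & ? & ? & ?).
rewrite !CInt_Cmult by assumption. ring.
Qed.

Lemma rint_ext g h x1 x2 y1 y2 : (x1 <= x2)%R -> (y1 <= y2)%R ->
  (forall p, rbd x1 x2 y1 y2 p -> g p = h p) -> rint g x1 x2 y1 y2 = rint h x1 x2 y1 y2.
Proof.
intros hx hy H. unfold rint.
rewrite (CInt_ext (fun t => g (t, y1) - g (t, y2)) (fun t => h (t, y1) - h (t, y2)) x1 x2 hx),
  (CInt_ext (fun t => g (x2, t) - g (x1, t)) (fun t => h (x2, t) - h (x1, t)) y1 y2 hy);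
  auto; intros t Ht.
- rewrite (H (x1, t)), (H (x2, t)); auto; split; simpl; auto; try split; auto; lra.
- rewrite (H (t, y1)), (H (t, y2)); auto; split; simpl; auto; split; auto; lra.
Qed.

Lemma rint_le g x1 x2 y1 y2 M : (x1 <= x2)%R -> (y1 <= y2)%R -> rcont g x1 x2 y1 y2 ->
  (forall p, rbd x1 x2 y1 y2 p -> (Cmod (g p) <= M)%R) ->
  (Cmod (rint g x1 x2 y1 y2) <= 2 * ((x2 - x1) + (y2 - y1)) * M)%R.
Proof.
intros hx hy Hg HM. unfold rint. eapply Rle_trans. apply Cmod_triangle.
rewrite Cmod_mult, Cmod_Ci, Rmult_1_l.
destruct (rcont_sides _ _ _ _ _ hx hy Hg) as (? & ? & ? & ?).
assert (D : forall u v : C, (Cmod u <= M -> Cmod v <= M -> Cmod (u - v)%C <= 2 * M)%R).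
{ intros u v Hu Hv. eapply Rle_trans. apply Cmod_triangle. rewrite Cmod_opp. lra. }
assert (I1 : (Cmod (CInt (fun t => (g (t, y1) - g (t, y2))%C) x1 x2) <= (x2 - x1) * (2 * M))%R).
{ apply CInt_le; auto. apply Ccont_seg_minus; auto.
  intros t Ht. apply D; apply HM; split; simpl; auto; try split; auto; lra. }
assert (I2 : (Cmod (CInt (fun t => (g (x2, t) - g (x1, t))%C) y1 y2) <= (y2 - y1) * (2 * M))%R).
{ apply CInt_le; auto. apply Ccont_seg_minus; auto.
  intros t Ht. apply D; apply HM; split; simpl; auto; try split; auto; lra. }
lra.
Qed.

Lemma rint_split_x g x1 m x2 y1 y2 : (x1 <= m)%R -> (m <= x2)%R -> (y1 <= y2)%R ->
  rcont g x1 m y1 y2 -> rcont g m x2 y1 y2 ->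
  rint g x1 x2 y1 y2 = rint g x1 m y1 y2 + rint g m x2 y1 y2.
Proof.
intros h1 h2 hy Hl Hr.
assert (H : rcont g x1 x2 y1 y2).
{ intros p (A & B & D). destruct (Rle_dec (fst p) m).
  - destruct D as [D|[D|D]]; first [apply Hl; repeat split; auto; lra | apply Hr; repeat split; auto; lra].
  - destruct D as [D|[D|D]]; apply Hr; repeat split; auto; lra. }
rewrite !rint_sides by (auto; lra).
rewrite <- (CInt_Chasles (fun t => g (t, y1)) x1 m x2), <- (CInt_Chasles (fun t => g (t, y2)) x1 m x2) by (auto; apply (rcont_sides _ _ _ _ _ (Rle_trans _ _ _ h1 h2) hy H)).
ring.
Qed.

Lemma rint_split_y g x1 x2 y1 m y2 : (y1 <= m)%R -> (m <= y2)%R -> (x1 <= x2)%R ->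
  rcont g x1 x2 y1 m -> rcont g x1 x2 m y2 ->
  rint g x1 x2 y1 y2 = rint g x1 x2 y1 m + rint g x1 x2 m y2.
Proof.
intros h1 h2 hx Hl Hr.
assert (H : rcont g x1 x2 y1 y2).
{ intros p (A & B & D). destruct (Rle_dec (snd p) m).
  - destruct D as [D|[D|[D|D]]]; first [apply Hl; repeat split; auto; lra | apply Hr; repeat split; auto; lra].
  - destruct D as [D|[D|[D|D]]]; apply Hr; repeat split; auto; lra. }
rewrite !rint_sides by (auto; lra).
rewrite <- (CInt_Chasles (fun t => g (x1, t)) y1 m y2), <- (CInt_Chasles (fun t => g (x2, t)) y1 m y2) by (auto; apply (rcont_sides _ _ _ _ _ hx (Rle_trans _ _ _ h1 h2) H)).
ring.
Qed.

(** The values on opposite sides differ by constants, -i a (y2 - y1) and a (x2 - x1), and the two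
    contributions cancel. *)
Lemma rint_affine (c a : C) x1 x2 y1 y2 : (x1 <= x2)%R -> (y1 <= y2)%R ->
  rint (fun p => c + a * p) x1 x2 y1 y2 = 0.
Proof.
intros hx hy. unfold rint.
rewrite (CInt_ext _ (fun _ => a * ((0, y1 - y2)%R : C))); auto.
2:{ intros t _. transitivity (a * ((t, y1) - (t, y2))). ring. f_equal. apply injective_projections; simpl; ring. }
rewrite (CInt_ext _ (fun _ => a * ((x2 - x1, 0)%R : C)) y1); auto.
2:{ intros t _. transitivity (a * ((x2, t) - (x1, t))). ring. f_equal. apply injective_projections; simpl; ring. }
rewrite !CInt_const. destruct a. apply injective_projections; simpl; ring.
Qed.

Lemma bisection (P : R -> R -> R -> R -> Prop) (A B A' B' : R) :
  (forall a b a' b', {P a b a' b'} + {~ P a b a' b'}) ->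
  (forall a b a' b', (A <= a <= b)%R -> (b <= B)%R -> (A' <= a' <= b')%R -> (b' <= B')%R ->
    P a ((a + b) / 2)%R a' ((a' + b') / 2)%R -> P ((a + b) / 2)%R b a' ((a' + b') / 2)%R ->
    P a ((a + b) / 2)%R ((a' + b') / 2)%R b' -> P ((a + b) / 2)%R b ((a' + b') / 2)%R b' ->
    P a b a' b') ->
  (forall x y, (A <= x <= B)%R -> (A' <= y <= B')%R -> exists d : posreal,
    forall a b a' b', (A <= a <= x)%R -> (x <= b <= B)%R -> (A' <= a' <= y)%R -> (y <= b' <= B')%R ->
      (b - a < d)%R -> (b' - a' < d)%R -> P a b a' b') ->
  (A <= B)%R -> (A' <= B')%R -> P A B A' B'.
Proof.
intros dec split loc hA hA'.
destruct (dec A B A' B') as [|nP]; auto. exfalso.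
(* The first failing quarter is selected. The fourth one is taken untested: if the other three
   satisfy [P], it has to fail. *)
set (step := fun q : R * R * R * R => let '(a, b, a', b') := q in
  let m := ((a + b) / 2)%R in let m' := ((a' + b') / 2)%R in
  if dec a m a' m' then if dec m b a' m' then if dec a m m' b' then (m, b, m', b')
  else (a, m, m', b') else (m, b, a', m') else (a, m, a', m')).
set (s := fun n => Nat.iter n step (A, B, A', B')).
set (sa := fun n => fst (fst (fst (s n)))). set (sb := fun n => snd (fst (fst (s n)))).
set (ta := fun n => snd (fst (s n))). set (tb := fun n => snd (s n)).
assert (inv : forall n, (A <= sa n <= sb n)%R /\ (sb n <= B)%R /\ (A' <= ta n <= tb n)%R /\ (tb n <= B')%R /\
  ~ P (sa n) (sb n) (ta n) (tb n) /\ (sb n - sa n = (B - A) / 2 ^ n)%R /\ (tb n - ta n = (B' - A') / 2 ^ n)%R /\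
  (sa n <= sa (S n))%R /\ (sb (S n) <= sb n)%R /\ (ta n <= ta (S n))%R /\ (tb (S n) <= tb n)%R).
{ assert (E : forall n, s (S n) = step (s n)) by reflexivity.
  assert (key : forall n, (A <= sa n <= sb n)%R /\ (sb n <= B)%R /\ (A' <= ta n <= tb n)%R /\ (tb n <= B')%R /\
     ~ P (sa n) (sb n) (ta n) (tb n) /\ (sb n - sa n = (B - A) / 2 ^ n)%R /\ (tb n - ta n = (B' - A') / 2 ^ n)%R ->
     ((A <= sa (S n) <= sb (S n))%R /\ (sb (S n) <= B)%R /\ (A' <= ta (S n) <= tb (S n))%R /\ (tb (S n) <= B')%R /\
     ~ P (sa (S n)) (sb (S n)) (ta (S n)) (tb (S n)) /\ (sb (S n) - sa (S n) = (B - A) / 2 ^ (S n))%R /\ (tb (S n) - ta (S n) = (B' - A') / 2 ^ (S n))%R)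
     /\ (sa n <= sa (S n))%R /\ (sb (S n) <= sb n)%R /\ (ta n <= ta (S n))%R /\ (tb (S n) <= tb n)%R).
  { intros n. unfold sa, sb, ta, tb. rewrite E. destruct (s n) as [[[a b] a'] b']. simpl fst; simpl snd.
    intros (h1 & h2 & h3 & h4 & h5 & h6 & h7).
    assert (p2 : forall x : R, (x / 2 ^ S n = x / 2 ^ n / 2)%R).
    { intros x. simpl. field. apply pow_nonzero. lra. }
    rewrite !p2, <- h6, <- h7.
    unfold step. destruct (dec _ _ _ _) as [q1|q1]; [destruct (dec ((a + b) / 2)%R b a' ((a' + b') / 2)%R) as [q2|q2]; [destruct (dec a ((a + b) / 2)%R ((a' + b') / 2)%R b') as [q3|q3]|]|];
    simpl; repeat split; try lra; auto. }
  intros n. assert (I : (A <= sa n <= sb n)%R /\ (sb n <= B)%R /\ (A' <= ta n <= tb n)%R /\ (tb n <= B')%R /\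
     ~ P (sa n) (sb n) (ta n) (tb n) /\ (sb n - sa n = (B - A) / 2 ^ n)%R /\ (tb n - ta n = (B' - A') / 2 ^ n)%R).
  { induction n as [|n IH].
    - unfold sa, sb, ta, tb; simpl. repeat split; auto; try lra.
    - exact (proj1 (key n IH)). }
  assert (J := proj2 (key n I)). tauto. }
assert (nest : forall u v : nat -> R, (forall n, u n <= v n /\ u n <= u (S n) /\ v (S n) <= v n)%R ->
  exists x, forall n, (u n <= x <= v n)%R).
{ intros u v Huv.
  assert (mu : forall n k, (u n <= u (n + k)%nat)%R).
  { intros n k. induction k. rewrite Nat.add_0_r. lra. rewrite Nat.add_succ_r. generalize (Huv (n + k)%nat). lra. }
  assert (mv : forall n k, (v (n + k)%nat <= v n)%R).
  { intros n k. induction k. rewrite Nat.add_0_r. lra. rewrite Nat.add_succ_r. generalize (Huv (n + k)%nat). lra. }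
  assert (uv : forall n m, (u n <= v m)%R).
  { intros n m. generalize (mu n m) (mv m n) (Huv (n + m)%nat). rewrite (Nat.add_comm m n). lra. }
  destruct (completeness (fun y => exists n, y = u n)) as [x [ub lub]].
  - exists (v 0%nat). intros y [n ->]. apply uv.
  - exists (u 0%nat). exists 0%nat. auto.
  - exists x. intros n. split. apply ub. exists n; auto. apply lub. intros y [m ->]. apply uv. }
destruct (nest sa sb) as [x Hx]. { intros n. destruct (inv n) as (? & ? & ? & ? & ? & ? & ? & ? & ? & ? & ?). repeat split; lra. }
destruct (nest ta tb) as [y Hy]. { intros n. destruct (inv n) as (? & ? & ? & ? & ? & ? & ? & ? & ? & ? & ?). repeat split; lra. }
destruct (loc x y) as [d Hd].
{ generalize (Hx 0%nat). unfold sa, sb; simpl; lra. }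
{ generalize (Hy 0%nat). unfold ta, tb; simpl; lra. }
assert (Hn : exists n, ((B - A) / 2 ^ n < d)%R /\ ((B' - A') / 2 ^ n < d)%R).
(* [L] dominates both side lengths, and the summand 1 keeps it positive for a degenerate
   rectangle. *)
{ set (L := ((B - A) + (B' - A') + 1)%R).
  assert (L0 : (0 < d / L)%R). { apply Rdiv_lt_0_compat. apply d. unfold L; lra. }
  destruct (pow_lt_1_zero (/ 2) ltac:(rewrite Rabs_pos_eq; lra) _ L0) as [n Hn].
  exists n. specialize (Hn n (le_n n)). rewrite Rabs_pos_eq in Hn by (apply pow_le; lra).
  rewrite pow_inv in Hn. 
  assert (p0 : (0 < / 2 ^ n)%R) by (apply Rinv_0_lt_compat, pow_lt; lra).
  assert (Lp : (0 < L)%R) by (unfold L; lra).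
  assert (H : (L * / 2 ^ n < d)%R).
  { apply (Rmult_lt_compat_l L) in Hn; auto. replace (L * (d / L))%R with (pos d) in Hn by (field; lra). auto. }
  unfold Rdiv, L in *. split; nra. }
destruct Hn as [n [n1 n2]].
destruct (inv n) as (h1 & h2 & h3 & h4 & h5 & h6 & h7 & _). apply h5. apply Hd; try lra.
all: generalize (Hx n) (Hy n); lra.
Qed.

Lemma Cmod_le_sum (z : C) : (Cmod z <= Rabs (fst z) + Rabs (snd z))%R.
Proof.
destruct z as [x y]. simpl.
assert (E : ((x, y) : C) = RtoC x + Ci * RtoC y) by (apply injective_projections; simpl; ring).
rewrite E. eapply Rle_trans. apply Cmod_triangle. rewrite Cmod_mult, Cmod_Ci, !Cmod_R. lra.
Qed.

Definition rin (x1 x2 y1 y2 : R) (p : C) : Prop :=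
  (x1 <= fst p <= x2)%R /\ (y1 <= snd p <= y2)%R.

(** Near a point [p], [g] is an affine function, whose contour integral is zero, plus (q w - q p) (w
    - p), which is small compared with the diameter. Hence small rectangles satisfy a bound by [e]
    times a square, and bisection carries it to the whole rectangle. *)
Lemma goursat g x1 x2 y1 y2 : (x1 <= x2)%R -> (y1 <= y2)%R ->
  (forall p, rin x1 x2 y1 y2 p -> cdiff g p) -> rint g x1 x2 y1 y2 = 0.
Proof.
intros hx hy Hg. apply Cmod_eq_0. apply Rle_antisym; [|apply Cmod_ge_0].
set (W := (x2 - x1 + (y2 - y1))%R).
assert (cont : forall a b a' b', (x1 <= a)%R -> (b <= x2)%R -> (y1 <= a')%R -> (b' <= y2)%R -> rcont g a b a' b').
{ intros a b a' b' ? ? ? ? p (? & ? & _). apply cdiff_continuous, Hg. split; lra. }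
assert (key : forall e : posreal, (Cmod (rint g x1 x2 y1 y2) <= e * (W * W))%R).
{ intros e. unfold W.
  (* The square of the half-perimeter is exactly distributed among the four quarters. *)
  apply (bisection (fun a b a' b' => (Cmod (rint g a b a' b') <= e * ((b - a + (b' - a')) * (b - a + (b' - a'))))%R) x1 x2 y1 y2); auto.
  { intros; apply Rle_dec. }
  { intros a b a' b' Ha Hb Ha' Hb' h1 h2 h3 h4.
    rewrite (rint_split_x g a ((a + b) / 2) b a' b') by (try apply cont; lra).
    rewrite (rint_split_y g a _ a' ((a' + b') / 2) b') by (try apply cont; lra).
    rewrite (rint_split_y g _ b a' ((a' + b') / 2) b') by (try apply cont; lra).
    eapply Rle_trans. apply Cmod_triangle.
    assert (T1 := Cmod_triangle (rint g a ((a + b) / 2) a' ((a' + b') / 2)) (rint g a ((a + b) / 2) ((a' + b') / 2) b')).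
    assert (T2 := Cmod_triangle (rint g ((a + b) / 2) b a' ((a' + b') / 2)) (rint g ((a + b) / 2) b ((a' + b') / 2) b')).
    assert (H := cond_pos e). nra. }
  intros x y Hx Hy. destruct (Hg (x, y)) as [q [Hq E]]. split; auto.
  assert (e2 : (0 < e / 2)%R) by (generalize (cond_pos e); lra).
  destruct (proj1 (locally_Cmod _ _) (proj1 (continuous_Cmod q (x, y)) Hq (mkposreal _ e2))) as [d Hd]. simpl in Hd.
  (* The modulus of w - p is bounded by the sum of the two side lengths, so each must be below d /
     2. *)
  assert (d2 : (0 < d / 2)%R) by (generalize (cond_pos d); lra).
  exists (mkposreal _ d2). simpl. intros a b a' b' Ha Hb Ha' Hb' sa sb.
  set (p := (x, y) : C) in *.
  set (rem := fun w => g w + ((q p * p - g p) + (- q p) * w)).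
  assert (Crem : rcont rem a b a' b').
  { intros w Hw. unfold rem. ccont. apply (cont a b a' b'); auto; lra. }
  assert (Caff : forall c k, rcont (fun w => c + k * w) a b a' b') by (intros c k w _; ccont).
  rewrite (rint_ext g (fun w => rem w + ((g p - q p * p) + q p * w))) by (try lra; intros; unfold rem; ring).
  rewrite rint_plus by (auto; lra). rewrite rint_affine by lra. rewrite Cplus_0_r.
  replace (e * ((b - a + (b' - a')) * (b - a + (b' - a'))))%R
    with (2 * (b - a + (b' - a')) * (e / 2 * (b - a + (b' - a'))))%R by field.
  apply rint_le; auto; try lra.
  intros w (W1 & W2 & _).
  replace (rem w) with ((q w - q p) * (w - p)) by (unfold rem; rewrite (E w); ring).
  rewrite Cmod_mult.
  assert (B : (Cmod (w - p) <= b - a + (b' - a'))%R).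
  { eapply Rle_trans. apply Cmod_le_sum. destruct w as [w1 w2]; simpl in *.
    apply Rplus_le_compat; apply Rabs_le; lra. }
  apply Rmult_le_compat; try apply Cmod_ge_0; auto. apply Rlt_le, Hd. lra. }
apply Rle_trans with (2 * 0)%R; [|lra].
apply le_epsilon. intros e He.
assert (e' : (0 < e / (W * W + 1))%R) by (apply Rdiv_lt_0_compat; nra).
eapply Rle_trans. apply (key (mkposreal _ e')). simpl.
apply Rle_trans with (e / (W * W + 1) * (W * W + 1))%R.
apply Rmult_le_compat_l; lra. right. field. nra.
Qed.

(** * The kernel 1 / (w - z) and Cauchy's formula *)

Lemma rint_deflate g z x1 x2 y1 y2 d : (0 < d)%R ->
  (x1 <= fst z - d)%R -> (fst z + d <= x2)%R -> (y1 <= snd z - d)%R -> (snd z + d <= y2)%R ->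
  (forall p, rin x1 x2 y1 y2 p -> p <> z -> cdiff g p) ->
  rint g x1 x2 y1 y2 = rint g (fst z - d) (fst z + d) (snd z - d) (snd z + d).
Proof.
intros hd h1 h2 h3 h4 Hg.
assert (cont : forall a b a' b', (x1 <= a)%R -> (b <= x2)%R -> (y1 <= a')%R -> (b' <= y2)%R ->
  a <> fst z -> b <> fst z -> a' <> snd z -> b' <> snd z -> rcont g a b a' b').
{ intros a b a' b' ? ? ? ? ? ? ? ? p (? & ? & D). apply cdiff_continuous, Hg. split; lra.
  intros ->. destruct D as [D|[D|[D|D]]]; auto. }
(* The rectangle is cut into left, right, lower and upper pieces around the square centred at [z];
   these four avoid [z], so Goursat's lemma removes them. *)
rewrite (rint_split_x g x1 (fst z - d) x2) by (try apply cont; lra).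
rewrite (rint_split_x g (fst z - d) (fst z + d) x2) by (try apply cont; lra).
rewrite (rint_split_y g (fst z - d) (fst z + d) y1 (snd z - d) y2) by (try apply cont; lra).
rewrite (rint_split_y g (fst z - d) (fst z + d) (snd z - d) (snd z + d) y2) by (try apply cont; lra).
rewrite (goursat g x1 (fst z - d)); try lra.
2:{ intros p [P1 P2]. apply Hg. split; lra. intros ->. lra. }
rewrite (goursat g (fst z + d) x2); try lra.
2:{ intros p [P1 P2]. apply Hg. split; lra. intros ->. lra. }
rewrite (goursat g _ _ y1 (snd z - d)); try lra.
2:{ intros p [P1 P2]. apply Hg. split; lra. intros ->. lra. }
rewrite (goursat g _ _ (snd z + d) y2); try lra.
2:{ intros p [P1 P2]. apply Hg. split; lra. intros ->. lra. }
ring.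
Qed.

(** Up to a factor i, this integrand is the difference of 1 / (w - z) on two opposite sides of a
    square of half-side [d]. The argument of atan runs from -1 to 1, giving 2 (pi/4 + pi/4). *)
Lemma is_RInt_atan (c d : R) : (0 < d)%R ->
  is_RInt (fun t => 2 * d / ((t - c) * (t - c) + d * d))%R (c - d) (c + d) PI.
Proof.
intros hd.
replace PI with (minus (2 * atan ((c + d - c) / d)) (2 * atan ((c - d - c) / d)))%R.
apply (is_RInt_derive (V := R_CompleteNormedModule) (fun t => 2 * atan ((t - c) / d))%R).
- intros x _.
  evar_last. apply is_derive_scal. apply (is_derive_comp (V := R_NormedModule)). apply is_derive_atan.
  auto_derive. auto. reflexivity. 
  simpl. unfold scal; simpl; unfold mult; simpl. unfold Rsqr. field. repeat split; try lra; apply Rgt_not_eq; generalize (Rle_0_sqr (x - c)) (Rmult_lt_0_compat d d hd hd); unfold Rsqr; intros; nra.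
- intros x _. apply (ex_derive_continuous (V := R_NormedModule)). auto_derive. apply Rgt_not_eq; generalize (Rle_0_sqr (x - c)) (Rmult_lt_0_compat d d hd hd); unfold Rsqr; intros; nra.
- replace ((c + d - c) / d)%R with 1%R by (field; lra).
  replace ((c - d - c) / d)%R with (- (1))%R by (field; lra).
  rewrite atan_opp, atan_1. unfold minus, plus, opp; simpl. field.
Qed.

(** Each pair of opposite sides contributes pi i. *)
Lemma rint_Cinv (z : C) (d : R) : (0 < d)%R ->
  rint (fun w => / (w - z)) (fst z - d) (fst z + d) (snd z - d) (snd z + d) = 2 * PI * Ci.
Proof.
intros hd. destruct z as [a b]. simpl. unfold rint.
assert (H1 : CInt (fun t => / ((t, b - d)%R - (a, b)) - / ((t, b + d)%R - (a, b))) (a - d) (a + d) = (0, PI)%R).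
{ rewrite (CInt_ext _ (fun t => (0, 2 * d / ((t - a) * (t - a) + d * d))%R)).
  apply (is_RInt_unique (V := C_R_CompleteNormedModule)).
  apply (is_RInt_fct_extend_pair (U := R_NormedModule) (V := R_NormedModule)); simpl.
  evar_last. apply (is_RInt_const (V := R_NormedModule)). apply (scal_zero_r (V := R_ModuleSpace)).
  apply is_RInt_atan; auto. lra.
  intros t _. apply injective_projections; simpl; field; repeat split; apply Rgt_not_eq; generalize (Rle_0_sqr (t - a)) (Rmult_lt_0_compat d d hd hd); unfold Rsqr; intros; nra. }
assert (H2 : CInt (fun t => / ((a + d, t)%R - (a, b)) - / ((a - d, t)%R - (a, b))) (b - d) (b + d) = (PI, 0)%R).
{ rewrite (CInt_ext _ (fun t => (2 * d / ((t - b) * (t - b) + d * d), 0)%R)).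
  apply (is_RInt_unique (V := C_R_CompleteNormedModule)).
  apply (is_RInt_fct_extend_pair (U := R_NormedModule) (V := R_NormedModule)); simpl.
  apply is_RInt_atan; auto. 
  evar_last. apply (is_RInt_const (V := R_NormedModule)). apply (scal_zero_r (V := R_ModuleSpace)).
  lra.
  intros t _. apply injective_projections; simpl; field; repeat split; apply Rgt_not_eq; generalize (Rle_0_sqr (t - b)) (Rmult_lt_0_compat d d hd hd); unfold Rsqr; intros; nra. }
rewrite H1, H2. apply injective_projections; simpl; ring.
Qed.

Lemma rbd_neq z d p : (0 < d)%R -> rbd (fst z - d) (fst z + d) (snd z - d) (snd z + d) p -> p <> z.
Proof. intros hd (_ & _ & D) ->. lra. Qed.

Lemma Cminus_neq (a b : C) : a <> b -> a - b <> 0.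
Proof. intros H E. apply H. replace a with (a - b + b) by ring. rewrite E. ring. Qed.

(** After shrinking the contour to a small square, f w / (w - z) is f z / (w - z) plus the
    Caratheodory quotient [q], which is bounded near [z]; its integral tends to 0 with the side
    length. *)
Lemma cauchy_formula f z x1 x2 y1 y2 :
  (x1 < fst z < x2)%R -> (y1 < snd z < y2)%R -> (forall p, rin x1 x2 y1 y2 p -> cdiff f p) ->
  rint (fun w => f w / (w - z)) x1 x2 y1 y2 = 2 * PI * Ci * f z.
Proof.
intros hx hy Hf.
destruct (Hf z) as [q [Hq E]]. split; lra.
destruct (proj1 (locally_Cmod _ _) (proj1 (continuous_Cmod q z) Hq (mkposreal 1 Rlt_0_1))) as [d0 Hd0]. simpl in Hd0.
set (L := (Cmod (q z) + 1)%R). assert (L0 : (0 < L)%R) by (unfold L; generalize (Cmod_ge_0 (q z)); lra).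
set (I := rint (fun w => f w / (w - z)) x1 x2 y1 y2).
assert (key : forall e : R, (0 < e)%R -> (Cmod (I - 2 * PI * Ci * f z) <= 0 + e)%R).
{ intros e He. unfold I.
  (* The first four bounds keep the square inside the rectangle, d0 / 4 keeps it where |q p - q z| <
     1, and e / (8 L) makes the length bound 8 d L at most [e]. *)
  set (d := Rmin (Rmin (fst z - x1) (x2 - fst z)) (Rmin (Rmin (snd z - y1) (y2 - snd z)) (Rmin (d0 / 4) (e / (8 * L))))).
  assert (D : (0 < d /\ d <= fst z - x1 /\ d <= x2 - fst z /\ d <= snd z - y1 /\ d <= y2 - snd z /\ d <= d0 / 4 /\ d <= e / (8 * L))%R).
  { assert (H0 := cond_pos d0). assert (H1 : (0 < e / (8 * L))%R) by (apply Rdiv_lt_0_compat; lra).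
    unfold d, Rmin; repeat destruct (Rle_dec _ _); lra. }
  destruct D as (d1 & d2 & d3 & d4 & d5 & d6 & d7). clearbody d.
  rewrite (rint_deflate _ z x1 x2 y1 y2 d) by
   (first [lra | intros p Hp np; (apply cdiff_mult; [apply Hf; auto|apply cdiff_inv; [apply cdiff_minus; [apply cdiff_id|apply cdiff_const]|apply Cminus_neq; auto]])]).
  assert (C1 : forall h : C -> C, (forall p, rin x1 x2 y1 y2 p -> continuous (T := C_UniformSpace) (U := C_UniformSpace) h p) ->
    rcont (fun w => h w * / (w - z)) (fst z - d) (fst z + d) (snd z - d) (snd z + d)).
  { intros h Hh p Hp. assert (np := rbd_neq _ _ _ d1 Hp). apply continuous_Cmult.
    destruct Hp as (? & ? & _). apply Hh; split; lra. apply continuous_Cinv. ccont. apply Cminus_neq; auto. }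
  rewrite (rint_ext _ (fun w => f z * / (w - z) + (f w - f z) * / (w - z))) by (try lra; intros; unfold Cdiv; ring).
  assert (C2 := C1 (fun w => f w - f z)). assert (C3 := C1 (fun _ => RtoC 1)). assert (C4 := C1 (fun _ => f z)).
  cbv beta in C2, C3, C4.
  rewrite rint_plus; try lra.
  2:{ apply C4. intros; ccont. }
  2:{ apply C2. intros; ccont. apply cdiff_continuous; auto. }
  rewrite (rint_ext (fun w => f z * / (w - z)) (fun w => f z * (1 * / (w - z)))) by (try lra; intros; ring).
  rewrite rint_Cmult; try lra. 2:{ apply C3. intros; ccont. }
  rewrite (rint_ext (fun w => 1 * / (w - z)) (fun w => / (w - z))) by (try lra; intros; ring).
  rewrite rint_Cinv by auto.
  replace (f z * (2 * PI * Ci) + rint (fun w => (f w - f z) * / (w - z)) (fst z - d) (fst z + d) (snd z - d) (snd z + d) - 2 * PI * Ci * f z)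
   with (rint (fun w => (f w - f z) * / (w - z)) (fst z - d) (fst z + d) (snd z - d) (snd z + d)) by ring.
  eapply Rle_trans. apply (rint_le _ _ _ _ _ L); try lra.
  { apply C2. intros; ccont. apply cdiff_continuous; auto. }
  { intros p Hp. assert (np := rbd_neq _ _ _ d1 Hp).
    replace ((f p - f z) * / (p - z)) with (q p) by (rewrite (E p); field; apply Cminus_neq; auto).
    assert (Hqp : (Cmod (q p - q z) < 1)%R).
    { apply Hd0. eapply Rle_lt_trans. apply Cmod_le_sum. destruct Hp as (p1 & p2 & _).
      destruct p as [u v], z as [z1 z2]; simpl in *.
      assert (Rabs (u + - z1) <= d)%R by (apply Rabs_le; lra).
      assert (Rabs (v + - z2) <= d)%R by (apply Rabs_le; lra). generalize (cond_pos d0); lra. }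
    assert (T := Cmod_triangle (q z) (q p - q z)). replace (q z + (q p - q z)) with (q p) in T by ring.
    unfold L; lra. }
  replace (fst z + d - (fst z - d) + (snd z + d - (snd z - d)))%R with (4 * d)%R by ring.
  apply (Rmult_le_compat_r (8 * L)) in d7; try lra. unfold Rdiv in d7. rewrite Rmult_assoc, Rinv_l in d7; lra. }
replace I with (I - 2 * PI * Ci * f z + 2 * PI * Ci * f z) by ring.
rewrite (Cmod_eq_0 (I - 2 * PI * Ci * f z)). ring.
apply Rle_antisym; [|apply Cmod_ge_0]. apply le_epsilon. auto.
Qed.

(** * Division along a graph *)

(** With this normalization the integral of f w / w^(n+1) is the n-th Taylor coefficient at 0 of a
    function [f] holomorphic on the square. *)
Definition sqint (r : R) (g : C -> C) : C := rint g (- r) r (- r) r / (2 * PI * Ci).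

Definition sqbd (r : R) (p : C) : Prop := rbd (- r) r (- r) r p.

Lemma Cmod_2PI_i : Cmod (2 * PI * Ci) = (2 * PI)%R.
Proof.
rewrite !Cmod_mult, Cmod_Ci, !Cmod_R, !Rabs_pos_eq; try ring. generalize PI_RGT_0; lra. lra.
Qed.

Lemma twoPIi_neq_0 : 2 * PI * Ci <> 0.
Proof. apply Cmod_gt_0. rewrite Cmod_2PI_i. generalize PI_RGT_0; lra. Qed.

Lemma sqbd_bounds r p : (0 < r)%R -> sqbd r p -> (r <= Cmod p <= 2 * r)%R.
Proof.
intros hr (h1 & h2 & h3). split.
- eapply Rle_trans. 2: apply Rmax_Cmod.
  destruct h3 as [D|[D|[D|D]]]; [eapply Rle_trans; [|apply Rmax_l] | eapply Rle_trans; [|apply Rmax_l]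
   | eapply Rle_trans; [|apply Rmax_r] | eapply Rle_trans; [|apply Rmax_r]]; rewrite D;
  [rewrite Rabs_left by lra|rewrite Rabs_pos_eq by lra|rewrite Rabs_left by lra|rewrite Rabs_pos_eq by lra]; lra.
- eapply Rle_trans. apply Cmod_le_sum.
  assert (Rabs (fst p) <= r)%R by (apply Rabs_le; lra).
  assert (Rabs (snd p) <= r)%R by (apply Rabs_le; lra). lra.
Qed.

Lemma sqbd_minus r p y : (0 < r)%R -> sqbd r p -> (Cmod y <= r / 2)%R -> (r / 2 <= Cmod (p - y))%R.
Proof.
intros hr hp hy. destruct (sqbd_bounds r p hr hp) as [h _].
assert (T := Cmod_triangle (p - y) y). replace (p - y + y) with p in T by ring. lra.
Qed.

Definition sqcont r (g : C -> C) : Prop := rcont g (- r) r (- r) r.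

(** Four terms are what the largest remainder, in [local_division], requires; shorter combinations
    are padded with coefficient 0. *)
Lemma sqint_lin r (g1 g2 g3 g4 : C -> C) (a b c : C) : (0 < r)%R ->
  sqcont r g1 -> sqcont r g2 -> sqcont r g3 -> sqcont r g4 ->
  sqint r (fun w => g1 w + a * g2 w + b * g3 w + c * g4 w) =
  sqint r g1 + a * sqint r g2 + b * sqint r g3 + c * sqint r g4.
Proof.
intros hr H1 H2 H3 H4. unfold sqint.
assert (K2 := rcont_Cmult a _ _ _ _ _ H2). assert (K3 := rcont_Cmult b _ _ _ _ _ H3).
assert (K4 := rcont_Cmult c _ _ _ _ _ H4).
assert (K12 := rcont_plus _ _ _ _ _ _ H1 K2). assert (K123 := rcont_plus _ _ _ _ _ _ K12 K3).
assert (hr' : (- r <= r)%R) by lra.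
rewrite (rint_plus _ _ _ _ _ _ hr' hr' K123 K4), (rint_plus _ _ _ _ _ _ hr' hr' K12 K3), (rint_plus _ _ _ _ _ _ hr' hr' H1 K2).
rewrite !rint_Cmult by assumption. unfold Cdiv. ring.
Qed.

Lemma sqint_ext r g h : (0 < r)%R -> (forall p, sqbd r p -> g p = h p) -> sqint r g = sqint r h.
Proof. intros hr H. unfold sqint. rewrite (rint_ext g h); auto; lra. Qed.

Lemma sqint_le r g M : (0 < r)%R -> sqcont r g -> (forall p, sqbd r p -> (Cmod (g p) <= M)%R) ->
  (Cmod (sqint r g) <= 8 * r * M)%R.
Proof.
intros hr Hg HM. unfold sqint. rewrite Cmod_div by exact twoPIi_neq_0. rewrite Cmod_2PI_i.
assert (H := rint_le g (- r) r (- r) r M ltac:(lra) ltac:(lra) Hg HM).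
(* The length of the contour is 8 r; the gain from dividing by 2 pi is given away. *)
assert (P : (1 <= 2 * PI)%R) by (generalize PI2_1; lra).
apply (Rmult_le_reg_r (2 * PI)). lra. unfold Rdiv. rewrite Rmult_assoc, Rinv_l by lra.
assert (0 <= M)%R. { eapply Rle_trans. apply Cmod_ge_0. apply (HM (r, 0%R)). repeat split; simpl; auto; lra. }
assert (0 <= 8 * r * M)%R by (apply Rmult_le_pos; lra). nra.
Qed.

Lemma sqcauchy r f z : (0 < r)%R -> (forall p, (Cmod p <= 2 * r)%R -> cdiff f p) -> (Cmod z <= r / 2)%R ->
  sqint r (fun w => f w / (w - z)) = f z.
Proof.
intros hr Hf hz. unfold sqint. rewrite cauchy_formula.
- generalize twoPIi_neq_0. generalize (2 * PI * Ci). intros k hk. field. auto.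
- assert (H := Rle_trans _ _ _ (Rle_trans _ _ _ (Rmax_l _ _) (Rmax_Cmod z)) hz).
  apply Rabs_le_between in H. lra.
- assert (H := Rle_trans _ _ _ (Rle_trans _ _ _ (Rmax_r _ _) (Rmax_Cmod z)) hz).
  apply Rabs_le_between in H. lra.
- intros p [h1 h2]. apply Hf. eapply Rle_trans. apply Cmod_le_sum.
  assert (Rabs (fst p) <= r)%R by (apply Rabs_le; lra).
  assert (Rabs (snd p) <= r)%R by (apply Rabs_le; lra). lra.
Qed.

Lemma sqcont_div r (f h : C -> C) : sqcont r f -> (forall p, sqbd r p -> h p <> 0) ->
  sqcont r h -> sqcont r (fun w => f w / h w).
Proof. intros Hf H0 Hh p Hp. apply continuous_Cdiv; [apply Hf | apply Hh | apply H0]; auto. Qed.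

Lemma Cmod_div_le (a b : C) (A B : R) : (Cmod a <= A)%R -> (0 < B)%R -> (B <= Cmod b)%R ->
  (Cmod (a / b) <= A / B)%R.
Proof.
intros ha hB hb. rewrite Cmod_div by (apply Cmod_gt_0; lra).
apply Rmult_le_compat; auto. apply Cmod_ge_0. apply Rlt_le, Rinv_0_lt_compat; lra.
apply Rinv_le_contravar; auto.
Qed.

Lemma sqbd_neq r p y : (0 < r)%R -> sqbd r p -> (Cmod y <= r / 2)%R -> p - y <> 0.
Proof. intros hr hp hy. apply Cmod_gt_0. generalize (sqbd_minus r p y hr hp hy). lra. Qed.

Lemma sqbd_neq0 r p : (0 < r)%R -> sqbd r p -> p <> 0.
Proof. intros hr hp. apply Cmod_gt_0. generalize (sqbd_bounds r p hr hp). lra. Qed.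

(** The remainder has the kernel 1/(w - x) - 1/w - x/w^2 = x^2 / (w^2 (w - x)). On the contour |w|
    >= r and |w - x| >= r / 2, so [sqint_le] yields 8 r M |x|^2 / (r^2 (r / 2)), the stated
    bound. *)
Lemma taylor2 r f M x : (0 < r)%R -> (forall p, (Cmod p <= 2 * r)%R -> cdiff f p) ->
  (forall p, (Cmod p <= 2 * r)%R -> (Cmod (f p) <= M)%R) -> (Cmod x <= r / 2)%R ->
  (Cmod (f x - f 0 - x * sqint r (fun w => (f w / (w * w))%C)) <= 16 * M / (r * r) * (Cmod x * Cmod x))%R.
Proof.
intros hr Hf HM hx.
assert (h0 : (Cmod 0 <= r / 2)%R) by (rewrite Cmod_0; lra).
assert (Cf : sqcont r f).
{ intros p hp. apply cdiff_continuous, Hf. apply sqbd_bounds; auto. }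
rewrite <- (sqcauchy r f x), <- (sqcauchy r f 0) by auto.
set (k := fun w => f w / (w * w * (w - x))).
assert (Ck : forall y, (Cmod y <= r / 2)%R -> sqcont r (fun w => f w / (w - y))).
{ intros y hy. apply sqcont_div; auto. intros; apply (sqbd_neq r); auto. intros p _; ccont. }
assert (C2 : sqcont r (fun w => f w / (w * w))).
{ apply sqcont_div; auto. intros p hp; apply Cmult_neq_0; apply (sqbd_neq0 r); auto. intros p _; ccont. }
replace (sqint r (fun w => f w / (w - x)) - sqint r (fun w => f w / (w - 0)) - x * sqint r (fun w => f w / (w * w)))
 with (sqint r (fun w => f w / (w - x)) + (- (1)) * sqint r (fun w => f w / (w - 0)) + (- x) * sqint r (fun w => f w / (w * w)) + 0 * sqint r (fun w => f w / (w * w))) by ring.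
rewrite <- sqint_lin by auto.
replace (16 * M / (r * r) * (Cmod x * Cmod x))%R with (8 * r * ((Cmod x * Cmod x * M) / (r * r * (r / 2))))%R by (field; lra).
apply sqint_le; auto.
{ intros p hp. generalize (Ck x hx p hp) (Ck 0 h0 p hp) (C2 p hp). intros. ccont. }
intros p hp.
assert (n1 := sqbd_neq0 r p hr hp). assert (n2 := sqbd_neq r p x hr hp hx).
replace (f p / (p - x) + - (1) * (f p / (p - 0)) + - x * (f p / (p * p)) + 0 * (f p / (p * p)))
 with ((x * x * f p) / (p * p * (p - x))).
2:{ replace (p - 0) with p by ring. field. auto. }
destruct (sqbd_bounds r p hr hp) as [b1 b2]. assert (b3 := sqbd_minus r p x hr hp hx).
apply Cmod_div_le.
- rewrite !Cmod_mult. apply Rmult_le_compat_l; auto. apply Rmult_le_pos; apply Cmod_ge_0.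
- apply Rmult_lt_0_compat; nra.
- rewrite !Cmod_mult. apply Rmult_le_compat; try nra.
Qed.

Lemma sqint_div_sq_le r f M : (0 < r)%R -> sqcont r f -> (forall p, sqbd r p -> (Cmod (f p) <= M)%R) ->
  (Cmod (sqint r (fun w => (f w / (w * w))%C)) <= 8 * M / r)%R.
Proof.
intros hr Hf HM. replace (8 * M / r)%R with (8 * r * (M / (r * r)))%R by (field; lra).
apply sqint_le; auto.
{ apply sqcont_div; auto. intros p hp; apply Cmult_neq_0; apply (sqbd_neq0 r); auto. intros p _; ccont. }
intros p hp. destruct (sqbd_bounds r p hr hp) as [b1 b2].
apply Cmod_div_le; auto. nra. rewrite Cmod_mult. nra.
Qed.

(** Differentiability of [J] is asked only at the origin, because [division_graph] recentres at
    every point of its graph. The continuity in the second variable identifies J (x, 0) with the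
    limit of F (x, y) / y. *)
Lemma local_division (F : C * C -> C) :
  locally (T := C2) (RtoC 0, RtoC 0) (fun u => cdiff2 F u) ->
  locally (T := C_UniformSpace) (RtoC 0) (fun x => F (x, RtoC 0) = 0) ->
  exists J : C * C -> C, cdiff2 J (RtoC 0, RtoC 0) /\
    locally (T := C2) (RtoC 0, RtoC 0) (fun u => F u = snd u * J u /\
      continuous (T := C_UniformSpace) (U := C_UniformSpace) (fun t => J (fst u, t)) (RtoC 0)).
Proof.
intros HF H0.
set (M := (Cmod (F (RtoC 0, RtoC 0)) + 1)%R).
assert (HM : locally (T := C2) (RtoC 0, RtoC 0) (fun u => (Cmod (F u) <= M)%R)).
{ assert (H := proj1 (continuous_Cmod F (RtoC 0, RtoC 0)) (cdiff2_continuous _ _ (locally_singleton (T := C2) _ _ HF)) (mkposreal 1 Rlt_0_1)).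
  revert H. apply filter_imp. simpl. intros u Hu. unfold M.
  assert (T := Cmod_triangle (F u - F (RtoC 0, RtoC 0)) (F (RtoC 0, RtoC 0))).
  replace (F u - F (RtoC 0, RtoC 0) + F (RtoC 0, RtoC 0)) with (F u) in T by ring. lra. }
destruct (proj1 (locally_C2 _ _) (filter_and _ _ HF HM)) as [d1 Hd1]. simpl in Hd1.
destruct (proj1 (locally_Cmod _ _) H0) as [d2 Hd2].
clear HF HM H0.
set (d := Rmin d1 d2).
assert (D : (0 < d /\ d <= d1 /\ d <= d2)%R).
{ generalize (cond_pos d1) (cond_pos d2). unfold d, Rmin; destruct (Rle_dec _ _); lra. }
destruct D as (d0 & D1 & D2). clearbody d.
assert (Z : forall x : C, x - 0 = x) by (intros; ring).
assert (Hdiff : forall x y, (Cmod x < d)%R -> (Cmod y < d)%R -> cdiff2 F (x, y)).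
{ intros x y hx hy. apply Hd1; rewrite Z; lra. }
assert (Hbd : forall x y, (Cmod x < d)%R -> (Cmod y < d)%R -> (Cmod (F (x, y)) <= M)%R).
{ intros x y hx hy. apply Hd1; rewrite Z; lra. }
assert (Hz : forall x, (Cmod x < d)%R -> F (x, RtoC 0) = 0).
{ intros x hx. apply Hd2; rewrite Z; lra. }
clear Hd1 Hd2 D1 D2 d1 d2.
(* The square of half-side [r] lies in the disc of radius 2 r < d, where all bounds on [F] hold. *)
set (r := (d / 4)%R). assert (hr : (0 < r)%R) by (unfold r; lra).
assert (r2 : (2 * r < d)%R) by (unfold r; lra).
assert (M0 : (0 < M)%R) by (unfold M; generalize (Cmod_ge_0 (F (RtoC 0, RtoC 0))); lra).
clearbody M.
(* [J] represents [F / y] by Cauchy's formula, without singularity at [y = 0]. *)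
set (J := fun u : C * C => sqint r (fun w => F (fst u, w) / (w * (w - snd u)))).
(* [A y] is the derivative of [F] in the first variable at (0, y), written as a Taylor
   coefficient. *)
set (A := fun y : C => sqint r (fun w => F (w, y) / (w * w))).
assert (h0 : (Cmod 0 <= r / 2)%R) by (rewrite Cmod_0; lra).
assert (Tx : forall x y, (Cmod x <= r / 2)%R -> (Cmod y < d)%R ->
  (Cmod (F (x, y) - F (RtoC 0, y) - x * A y) <= 16 * M / (r * r) * (Cmod x * Cmod x))%R).
{ intros x y hx hy. apply (taylor2 r (fun t => F (t, y))); auto.
  intros p hp. apply cdiff2_slice1, Hdiff; lra. intros p hp. apply Hbd; lra. }
assert (EJ : forall x y, J (x, y) = sqint r (fun w => F (x, w) / (w * (w - y)))) by reflexivity.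
assert (J0 : forall x, J (x, RtoC 0) = sqint r (fun w => F (x, w) / (w * w))).
{ intros x. rewrite EJ. apply sqint_ext; auto. intros p hp. rewrite Z. reflexivity. }
assert (Ty : forall x y, (Cmod y <= r / 2)%R -> (Cmod x < d)%R ->
  (Cmod (F (x, y) - y * J (x, RtoC 0)) <= 16 * M / (r * r) * (Cmod y * Cmod y))%R).
{ intros x y hy hx. rewrite J0. replace (F (x, y)) with (F (x, y) - F (x, RtoC 0)) by (rewrite Hz by auto; ring).
  apply (taylor2 r (fun t => F (x, t))); auto.
  intros p hp. apply cdiff2_slice2, Hdiff; lra. intros p hp. apply Hbd; lra. }
assert (CF : forall x, (Cmod x < d)%R -> sqcont r (fun w => F (x, w))).
{ intros x hx p hp. apply cdiff_continuous, cdiff2_slice2, Hdiff; auto. generalize (sqbd_bounds r p hr hp); lra. }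
assert (CFy : forall x y, (Cmod x < d)%R -> (Cmod y <= r / 2)%R -> sqcont r (fun w => F (x, w) / (w * (w - y)))).
{ intros x y hx hy. apply sqcont_div; auto.
  intros p hp. apply Cmult_neq_0. apply (sqbd_neq0 r); auto. apply (sqbd_neq r); auto. intros p _; ccont. }
(* Subtract Cauchy's formula at 0, where F (x, 0) = 0, from the one at [y]: 1/(w - y) - 1/w = y / (w
   (w - y)). *)
assert (FJ : forall x y, (Cmod x < d)%R -> (Cmod y <= r / 2)%R -> F (x, y) = y * J (x, y)).
{ intros x y hx hy. 
  assert (E : forall t, (Cmod t <= r / 2)%R -> sqint r (fun w => F (x, w) / (w - t)) = F (x, t)).
  { intros t ht. apply (sqcauchy r (fun w => F (x, w)) t); auto. intros p hp. apply cdiff2_slice2, Hdiff; lra. }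
  assert (Ck : forall t, (Cmod t <= r / 2)%R -> sqcont r (fun w => F (x, w) / (w - t))).
  { intros t ht. apply sqcont_div; auto. intros; apply (sqbd_neq r); auto. intros p _; ccont. }
  rewrite EJ. replace (F (x, y)) with (F (x, y) - F (x, RtoC 0)) by (rewrite (Hz x) by auto; ring).
  rewrite <- (E y), <- (E 0) by auto.
  rewrite (sqint_ext r (fun w => F (x, w) / (w - y)) (fun w => F (x, w) / (w - 0) + y * (F (x, w) / (w * (w - y)))
     + 0 * (F (x, w) / (w - 0)) + 0 * (F (x, w) / (w - 0)))); auto.
  2:{ intros p hp. assert (n1 := sqbd_neq0 r p hr hp). assert (n2 := sqbd_neq r p y hr hp hy).
      rewrite Z. field. auto. }
  rewrite sqint_lin by auto. ring. }
set (cM := (16 * M / (r * r))%R) in *. 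
assert (cM0 : (0 < cM)%R) by (apply Rdiv_lt_0_compat; nra).
assert (NA : forall y, (Cmod y < d)%R -> (Cmod (A y) <= 8 * M / r)%R).
{ intros y hy. apply (sqint_div_sq_le r (fun w => F (w, y)) M hr).
  - intros p hp. apply cdiff_continuous, cdiff2_slice1, Hdiff; auto. generalize (sqbd_bounds r p hr hp); lra.
  - intros p hp. apply Hbd; auto. generalize (sqbd_bounds r p hr hp); lra. }
(* [A] is a locally uniform limit of the quotients (F (t, w) - F (0, w)) / t, with error at most cM
   t. A small [t] is fixed first, then the continuity of F (t, .) and F (0, .) at [p] is used. *)
assert (CA : sqcont r A).
{ intros p hp. destruct (sqbd_bounds r p hr hp) as [b1 b2].
  apply continuous_Cmod. intros e.
  set (t := Rmin (r / 2) (e / (4 * cM))).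
  assert (T : (0 < t /\ t <= r / 2 /\ t <= e / (4 * cM))%R).
  { assert (0 < e / (4 * cM))%R by (apply Rdiv_lt_0_compat; [apply e|lra]).
    unfold t, Rmin; destruct (Rle_dec _ _); lra. }
  destruct T as (t0 & t1 & t2). clearbody t.
  assert (t3 : (cM * t <= e / 4)%R).
  { apply (Rmult_le_compat_l cM) in t2; try lra. replace (cM * (e / (4 * cM)))%R with (e / 4)%R in t2 by (field; lra). auto. }
  assert (Ct : Cmod t = t) by (rewrite Cmod_R, Rabs_pos_eq; lra).
  assert (e8 : (0 < e * t / 8)%R) by (generalize (cond_pos e); intros; nra).
  assert (K1 := proj1 (continuous_Cmod _ _) (cdiff_continuous _ _ (cdiff2_slice2 F t p (Hdiff t p ltac:(lra) ltac:(lra)))) (mkposreal _ e8)).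
  assert (K2 := proj1 (continuous_Cmod _ _) (cdiff_continuous _ _ (cdiff2_slice2 F 0 p (Hdiff 0 p ltac:(lra) ltac:(lra)))) (mkposreal _ e8)).
  assert (K3 : locally (T := C_UniformSpace) p (fun w => (Cmod w < d)%R)).
  { apply locally_Cmod. assert (dp : (0 < d - 2 * r)%R) by lra. exists (mkposreal _ dp). simpl. intros w Hw.
    assert (T := Cmod_triangle (w - p) p). replace (w - p + p) with w in T by ring. lra. }
  generalize (filter_and _ _ (filter_and _ _ K1 K2) K3). apply filter_imp. simpl.
  intros w [[L1 L2] L3].
  assert (X1 := Tx t w ltac:(lra) L3). assert (X2 := Tx t p ltac:(lra) ltac:(lra)). rewrite Ct in X1, X2.
  assert (E : t * (A w - A p) = (F (RtoC t, w) - F (RtoC t, p)) + - (F (RtoC 0, w) - F (RtoC 0, p))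
     + - (F (RtoC t, w) - F (RtoC 0, w) - t * A w) + (F (RtoC t, p) - F (RtoC 0, p) - t * A p)) by ring.
  apply (Rmult_lt_reg_l t); auto. rewrite <- Ct at 1. rewrite <- Cmod_mult, E.
  eapply Rle_lt_trans. apply Cmod_triangle. eapply Rle_lt_trans. apply Rplus_le_compat_r. apply Cmod_triangle.
  eapply Rle_lt_trans. apply Rplus_le_compat_r. apply Rplus_le_compat_r. apply Cmod_triangle.
  rewrite !Cmod_opp. generalize (cond_pos e). intros. nra. }
exists J. split.
- set (F0 := fun w => F (RtoC 0, w)).
  assert (hd0 : (Cmod 0 < d)%R) by (rewrite Cmod_0; lra).
  (* The partial derivatives of [J] at the origin, obtained by differentiating its kernel under the
     integral. *)
  set (a := sqint r (fun w => A w / (w * w))). set (b := sqint r (fun w => F0 w / (w * w * w))).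
  assert (Ca : sqcont r (fun w => A w / (w * w))).
  { apply sqcont_div; auto. intros p hp; apply Cmult_neq_0; apply (sqbd_neq0 r); auto. intros p _; ccont. }
  assert (C0 : sqcont r F0) by (apply CF; auto).
  assert (Cb : sqcont r (fun w => F0 w / (w * w * w))).
  { apply sqcont_div; auto. intros p hp; repeat apply Cmult_neq_0; apply (sqbd_neq0 r); auto. intros p _; ccont. }
  assert (C00 : sqcont r (fun w => F0 w / (w * w))).
  { apply sqcont_div; auto. intros p hp; repeat apply Cmult_neq_0; apply (sqbd_neq0 r); auto. intros p _; ccont. }
  (* One summand for each of the three error kernels in [main]: the Taylor error in x, the mixed
     term x y, and the square of y. *)
  set (L := (cM / (r * (r / 2)) + 8 * M / r / (r * r * (r / 2)) + M / (r * r * r * (r / 2)))%R).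
  assert (rr : (0 < r * r)%R) by nra. assert (rrr : (0 < r * r * r)%R) by nra.
  assert (L0 : (0 < L)%R).
  { unfold L. assert (0 < cM / (r * (r / 2)))%R by (apply Rdiv_lt_0_compat; nra).
    assert (0 < 8 * M / r / (r * r * (r / 2)))%R by (apply Rdiv_lt_0_compat; [apply Rdiv_lt_0_compat|]; nra).
    assert (0 < M / (r * r * r * (r / 2)))%R by (apply Rdiv_lt_0_compat; nra). lra. }
  assert (main : forall x y, (Cmod x <= r / 2)%R -> (Cmod y <= r / 2)%R ->
    (Cmod (J (x, y) - J (RtoC 0, RtoC 0) - a * x - b * y) <= 8 * r * (L * ((Cmod x + Cmod y) * (Cmod x + Cmod y))))%R).
  { intros x y hx hy. rewrite J0, EJ. fold (F0). 
    replace (sqint r (fun w => F (x, w) / (w * (w - y))) - sqint r (fun w => F (RtoC 0, w) / (w * w)) - a * x - b * y)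
     with (sqint r (fun w => F (x, w) / (w * (w - y))) + (- (1)) * sqint r (fun w => F0 w / (w * w)) + (- x) * a + (- y) * b)
     by (unfold F0; ring).
    unfold a, b. assert (hxd : (Cmod x < d)%R) by lra. rewrite <- sqint_lin by auto.
    apply sqint_le; auto.
    { intros p hp. generalize (CFy x y hxd hy p hp) (Ca p hp) (Cb p hp) (C00 p hp). intros. ccont. }
    intros p hp. destruct (sqbd_bounds r p hr hp) as [b1 b2].
    assert (n1 := sqbd_neq0 r p hr hp). assert (n2 := sqbd_neq r p y hr hp hy). assert (b3 := sqbd_minus r p y hr hp hy).
    assert (pd : (Cmod p < d)%R) by lra.
    replace (F (x, p) / (p * (p - y)) + - (1) * (F0 p / (p * p)) + - x * (A p / (p * p)) + - y * (F0 p / (p * p * p)))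
     with ((F (x, p) - F (RtoC 0, p) - x * A p) / (p * (p - y)) + (x * y * A p) / (p * p * (p - y)) + (y * y * F (RtoC 0, p)) / (p * p * p * (p - y))).
    2:{ unfold F0. field. auto. }
    assert (rp2 : (r * r <= Cmod p * Cmod p)%R) by nra.
    assert (rp3 : (r * r * r <= Cmod p * Cmod p * Cmod p)%R) by (apply Rmult_le_compat; lra).
    assert (S1 := Cmod_div_le _ (p * (p - y)) _ (r * (r / 2)) (Tx x p hx pd) ltac:(nra) ltac:(rewrite Cmod_mult; apply Rmult_le_compat; lra)).
    assert (S2 : (Cmod ((x * y * A p) / (p * p * (p - y))) <= (Cmod x * Cmod y * (8 * M / r)) / (r * r * (r / 2)))%R).
    { apply Cmod_div_le. rewrite !Cmod_mult. apply Rmult_le_compat_l. apply Rmult_le_pos; apply Cmod_ge_0. auto.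
      nra. rewrite !Cmod_mult. apply Rmult_le_compat; lra. }
    assert (S3 : (Cmod ((y * y * F (RtoC 0, p)) / (p * p * p * (p - y))) <= (Cmod y * Cmod y * M) / (r * r * r * (r / 2)))%R).
    { apply Cmod_div_le. rewrite !Cmod_mult. apply Rmult_le_compat_l. apply Rmult_le_pos; apply Cmod_ge_0. auto.
      nra. rewrite !Cmod_mult. apply Rmult_le_compat; lra. }
    eapply Rle_trans. apply Cmod_triangle. eapply Rle_trans. apply Rplus_le_compat_r. apply Cmod_triangle.
    eapply Rle_trans. apply Rplus_le_compat. apply Rplus_le_compat. exact S1. exact S2. exact S3.
    generalize (Cmod_ge_0 x) (Cmod_ge_0 y). set (X := Cmod x). set (Y := Cmod y). intros X0 Y0.
    assert (P1 : (0 <= cM / (r * (r / 2)))%R) by (apply Rlt_le, Rdiv_lt_0_compat; nra).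
    assert (P2 : (0 <= 8 * M / r / (r * r * (r / 2)))%R) by (apply Rlt_le, Rdiv_lt_0_compat; [apply Rdiv_lt_0_compat|]; nra).
    assert (P3 : (0 <= M / (r * r * r * (r / 2)))%R) by (apply Rlt_le, Rdiv_lt_0_compat; nra).
    unfold L.
    replace (cM * (X * X) / (r * (r / 2)))%R with (cM / (r * (r / 2)) * (X * X))%R by (field; lra).
    replace (X * Y * (8 * M / r) / (r * r * (r / 2)))%R with (8 * M / r / (r * r * (r / 2)) * (X * Y))%R by (field; lra).
    replace (Y * Y * M / (r * r * r * (r / 2)))%R with (M / (r * r * r * (r / 2)) * (Y * Y))%R by (field; lra).
    revert P1 P2 P3. generalize (cM / (r * (r / 2)))%R (8 * M / r / (r * r * (r / 2)))%R (M / (r * r * r * (r / 2)))%R.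
    intros u v w P1 P2 P3.
    assert (Q1 : (X * X <= (X + Y) * (X + Y))%R) by nra.
    assert (Q2 : (X * Y <= (X + Y) * (X + Y))%R) by nra.
    assert (Q3 : (Y * Y <= (X + Y) * (X + Y))%R) by nra.
    apply (Rmult_le_compat_l u) in Q1; auto. apply (Rmult_le_compat_l v) in Q2; auto. apply (Rmult_le_compat_l w) in Q3; auto.
    lra. }
  apply (cdiff2_intro _ _ a b). intros e. apply locally_C2. simpl fst; simpl snd.
  (* As |x| + |y| <= 2 s, the quadratic bound 8 r L (|x| + |y|)^2 is at most 16 r L s (|x| +
     |y|). *)
  set (s := Rmin (r / 2) (e / (16 * r * L))).
  assert (rL : (0 < 16 * r * L)%R) by (apply Rmult_lt_0_compat; lra).
  assert (S : (0 < s /\ s <= r / 2 /\ s <= e / (16 * r * L))%R).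
  { assert (0 < e / (16 * r * L))%R by (apply Rdiv_lt_0_compat; [apply e|auto]).
    unfold s, Rmin; destruct (Rle_dec _ _); lra. }
  destruct S as (s0 & s1 & s2). clearbody s.
  exists (mkposreal _ s0). simpl. intros x y hx hy. rewrite !Z in *.
  eapply Rle_trans. apply main; lra.
  assert (s3 : (s * (16 * r * L) <= e)%R).
  { apply Rle_div_r; auto. }
  generalize (Cmod_ge_0 x) (Cmod_ge_0 y). intros X0 Y0.
  replace (8 * r * (L * ((Cmod x + Cmod y) * (Cmod x + Cmod y))))%R with ((Cmod x + Cmod y) / 2 * (16 * r * L) * (Cmod x + Cmod y))%R by field.
  apply Rmult_le_compat_r. lra. eapply Rle_trans. 2: exact s3. apply Rmult_le_compat_r; lra.
- apply locally_C2. assert (r20 : (0 < r / 2)%R) by lra. exists (mkposreal _ r20). simpl. intros x y hx hy. rewrite Z in *.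
  split. apply FJ; lra.
  apply continuous_Cmod. intros e. apply locally_Cmod.
  (* [Ty] bounds |w| |J (x, w) - J (x, 0)| by cM |w|^2; one factor |w| is cancelled. *)
  set (s := Rmin (r / 2) (e / cM)).
  assert (S : (0 < s /\ s <= r / 2 /\ s <= e / cM)%R).
  { assert (0 < e / cM)%R by (apply Rdiv_lt_0_compat; [apply e|auto]).
    unfold s, Rmin; destruct (Rle_dec _ _); lra. }
  destruct S as (s0 & s1 & s2). clearbody s.
  exists (mkposreal _ s0). simpl. intros w hw. rewrite Z in hw.
  destruct (Req_EM_T (Cmod w) 0) as [W|W].
  { apply Cmod_eq_0 in W. subst w. unfold Cminus. rewrite Cplus_opp_r, Cmod_0. apply e. }
  assert (W0 : (0 < Cmod w)%R) by (generalize (Cmod_ge_0 w); lra).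
  assert (X := Ty x w ltac:(lra) ltac:(lra)). rewrite FJ in X by lra.
  replace (w * J (x, w) - w * J (x, RtoC 0)) with (w * (J (x, w) - J (x, RtoC 0))) in X by ring.
  rewrite Cmod_mult in X.
  assert (s3 : (s * cM <= e)%R).
  { apply Rle_div_r; auto. }
  apply (Rmult_lt_reg_l (Cmod w)); auto. eapply Rle_lt_trans. exact X. 
  replace (cM * (Cmod w * Cmod w))%R with (Cmod w * (Cmod w * cM))%R by ring.
  apply Rmult_lt_compat_l; auto. eapply Rlt_le_trans. 2: exact s3. apply Rmult_lt_compat_r; lra.
Qed.

(** The identity in [cdiff2] ranges over all points, so its locality is not visible from the
    definition; the filter formulation makes it so. *)
Lemma cdiff2_ext_loc (F G : C * C -> C) (p : C * C) :
  locally (T := C2) p (fun u => F u = G u) -> cdiff2 F p -> cdiff2 G p.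
Proof.
intros HL HF. apply ex_filterdiff_cdiff2. apply ex_filterdiff_cdiff2 in HF. destruct HF as [l Hl].
exists l. exact (filterdiff_ext_locally _ _ _ _ HL Hl).
Qed.

Lemma Ceq_dec (a b : C) : {a = b} + {a <> b}.
Proof.
destruct (Req_EM_T (Cmod (a - b)) 0) as [e|e].
- left. apply Cmod_eq_0 in e. replace a with (a - b + b) by ring. rewrite e. ring.
- right. intros E. apply e. subst b. replace (a - a) with (RtoC 0) by ring. apply Cmod_0.
Qed.

Lemma Ceq_minus (a b : C) : a = b -> a - b = 0.
Proof. intros ->. ring. Qed.

Definition open2 (D : C * C -> Prop) : Prop := forall p, D p -> locally (T := C2) p D.

Lemma continuous_pair2 {U : UniformSpace} (f g : U -> C) (D : C * C -> Prop) (p : U) :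
  continuous (U := C_UniformSpace) f p -> continuous (U := C_UniformSpace) g p ->
  locally (T := C2) (f p, g p) D -> locally p (fun u => D (f u, g u)).
Proof.
intros Hf Hg HD. apply locally_C2 in HD. destruct HD as [d Hd].
generalize (filter_and _ _ (proj1 (continuous_Cmod f p) Hf d) (proj1 (continuous_Cmod g p) Hg d)).
apply filter_imp. intros u [H1 H2]. apply Hd; auto.
Qed.

Lemma cdiff2_comp_fst phi (p : C * C) : cdiff phi (fst p) -> cdiff2 (fun u => phi (fst u)) p.
Proof. intros H. apply cdiff2_comp1; auto. apply cdiff2_fst. Qed.

Lemma division_graph (D : C * C -> Prop) (F : C * C -> C) (phi : C -> C) :
  open2 D -> (forall p, D p -> cdiff2 F p) -> (forall p, D p -> cdiff phi (fst p)) ->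
  (forall x, D (x, phi x) -> F (x, phi x) = 0) ->
  exists Q, (forall p, D p -> cdiff2 Q p) /\ forall p, D p -> F p = (snd p - phi (fst p)) * Q p.
Proof.
intros hD hF hphi hz.
(* The value on the graph is a limit, independent of any local choice, so the functions [J] found at
   different points need no gluing. *)
set (Q := fun p : C * C => if Ceq_dec (snd p) (phi (fst p))
  then C_lim (fun y => F (fst p, y) / (y - phi (fst p))) (phi (fst p)) else F p / (snd p - phi (fst p))).
exists Q. split.
2:{ intros [x y] hp. unfold Q. simpl. destruct (Ceq_dec _ _) as [e|e].
    - subst y. rewrite hz by auto. ring.
    - field. apply Cminus_neq; auto. }
intros p hp. 
assert (dphi := cdiff2_comp_fst phi p (hphi p hp)).
assert (dS := cdiff2_minus snd _ p (cdiff2_snd p) dphi).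
destruct (Ceq_dec (snd p) (phi (fst p))) as [e|e].
- set (x0 := fst p).
  (* [T1], [T2] straighten the graph: the axis of second coordinate 0 goes to it, and the origin to
     [p]. [S1], [S2] below are the inverse map. *)
  set (T1 := fun u : C * C => x0 + fst u). set (T2 := fun u : C * C => phi (x0 + fst u) + snd u).
  set (o := (RtoC 0, RtoC 0)).
  assert (e0 : x0 + 0 = x0) by ring.
  assert (hpx : cdiff phi x0) by (apply hphi; auto).
  assert (d1 : forall u, cdiff2 T1 u) by (intros u; apply cdiff2_plus; [apply cdiff2_const|apply cdiff2_fst]).
  assert (d2 : forall u, cdiff phi (T1 u) -> cdiff2 T2 u).
  { intros u Hu. apply cdiff2_plus; [|apply cdiff2_snd]. apply (cdiff2_comp1 phi T1); auto. }
  assert (Dp : D (x0, phi x0)).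
  { unfold x0. rewrite <- e. destruct p; exact hp. }
  assert (loc1 : locally (T := C2) o (fun u => D (T1 u, T2 u))).
  { apply (continuous_pair2 (U := C2) T1 T2).
    - apply cdiff2_continuous, d1.
    - apply cdiff2_continuous, d2. unfold T1, o; simpl. rewrite e0. auto.
    - apply hD. unfold T1, T2, o; simpl. rewrite e0, Cplus_0_r. auto. }
  destruct (local_division (fun u => F (T1 u, T2 u))) as (J & HJ & HF).
  { revert loc1. apply filter_imp. intros u Hu. apply (cdiff2_comp2 F T1 T2); auto. 
    apply d2. apply (hphi _ Hu). }
  { apply locally_C2 in loc1. destruct loc1 as [d Hd]. apply locally_Cmod. exists d. intros x Hx.
    assert (H : D (T1 (x, RtoC 0), T2 (x, RtoC 0))).
    { apply Hd; auto. unfold o; simpl. replace (0 - 0) with (RtoC 0) by ring. rewrite Cmod_0. apply d. }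
    revert H. unfold T1, T2; simpl. rewrite Cplus_0_r. apply hz. }
  set (S1 := fun v : C * C => fst v - x0). set (S2 := fun v : C * C => snd v - phi (fst v)).
  assert (ds1 : cdiff2 S1 p) by (apply cdiff2_minus; [apply cdiff2_fst|apply cdiff2_const]).
  assert (oS : (S1 p, S2 p) = o).
  { unfold S1, S2, o, x0. rewrite e. f_equal; ring. }
  apply (cdiff2_ext_loc (fun v => J (S1 v, S2 v))).
  2:{ apply (cdiff2_comp2 J S1 S2); auto. rewrite oS. auto. }
  assert (R1 : forall a b : C, a + (b - a) = b) by (intros; ring).
  assert (loc2 : locally (T := C2) p (fun v => F v = S2 v * J (S1 v, S2 v) /\
      continuous (T := C_UniformSpace) (U := C_UniformSpace) (fun t => J (S1 v, t)) (RtoC 0))).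
  { assert (H := fun D' => continuous_pair2 (U := C2) S1 S2 D' p (cdiff2_continuous _ _ ds1) (cdiff2_continuous _ _ dS)).
    rewrite oS in H. specialize (H _ HF). revert H. apply filter_imp. intros [x y]. simpl.
    unfold T1, T2, S1, S2; simpl. rewrite !R1. auto. }
  (* At a nearby graph point (x, phi x) the limit defining [Q] involves further points (x, y'), so
     the factorization is needed on a neighbourhood of each nearby point. *)
  apply locally_locally in loc2. revert loc2. apply filter_imp. intros [x y] Hv.
  destruct (locally_singleton (T := C2) _ _ Hv) as [E Cj]. unfold S1, S2 in *; simpl in *.
  unfold Q. simpl. destruct (Ceq_dec y (phi x)) as [e1|e1].
  + subst y. symmetry. replace (phi x - phi x) with (RtoC 0) by ring. apply is_C_lim_unique.
    apply locally_C2 in Hv. destruct Hv as [d Hd]. simpl in Hd.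
    intros P HP.
    assert (HJP : locally (T := C_UniformSpace) (phi x) (fun y => P (J (x - x0, y - phi x)))).
    { assert (H : continuous (T := C_UniformSpace) (U := C_UniformSpace) (fun y => J (x - x0, y - phi x)) (phi x)).
      { apply (continuous_comp (U := C_UniformSpace) (V := C_UniformSpace) (W := C_UniformSpace) (fun y => y - phi x) (fun t => J (x - x0, t))).
        ccont. replace (phi x - phi x) with (RtoC 0) by ring. auto. }
      apply H. replace (phi x - phi x) with (RtoC 0) by ring. auto. }
    assert (HdP : locally (T := C_UniformSpace) (phi x) (fun y => F (x, y) = (y - phi x) * J (x - x0, y - phi x))).
    { apply locally_Cmod. exists d. intros y Hy. apply Hd; auto.
      replace (x - x) with (RtoC 0) by ring. rewrite Cmod_0. apply d. }
    unfold filtermap, locally', within. generalize (filter_and _ _ HJP HdP). apply filter_imp. intros y [H1 H2] ny. change (P (F (x, y) / (y - phi x))). rewrite H2.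
    replace ((y - phi x) * J (x - x0, y - phi x) / (y - phi x)) with (J (x - x0, y - phi x)). auto.
    field. apply Cminus_neq; auto.
  + rewrite E. field. apply Cminus_neq; auto.
- apply (cdiff2_ext_loc (fun u => F u / (snd u - phi (fst u)))).
  + assert (H := continuous_neq (U := C2) (fun u => snd u - phi (fst u)) p (RtoC 0) (cdiff2_continuous _ _ dS) (Cminus_neq _ _ e)).
    revert H. apply filter_imp. intros u Hu. unfold Q. destruct (Ceq_dec _ _) as [e1|]; auto.
    exfalso. apply Hu. exact (Ceq_minus _ _ e1).
  + apply cdiff2_div; auto. apply Cminus_neq; auto.
Qed.

(** If H p were not zero, the first factor would vanish on a neighbourhood of [p]; but a vertical
    line meets the graph only once, and the shifts by d / 2 and d / 3 give two points on it. *)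
Lemma graph_cancel (D : C * C -> Prop) (H : C * C -> C) (phi : C -> C) :
  open2 D -> (forall p, D p -> cdiff2 H p) ->
  (forall p, D p -> (snd p - phi (fst p)) * H p = 0) -> forall p, D p -> H p = 0.
Proof.
intros hD hH hz p hp. destruct (Ceq_dec (H p) 0) as [e|n]; auto. exfalso.
assert (L := filter_and _ _ (hD p hp) (continuous_neq (U := C2) H p (RtoC 0) (cdiff2_continuous _ _ (hH p hp)) n)).
apply locally_C2 in L. destruct L as [d Hd]. destruct p as [x y]. simpl in Hd.
assert (d0 := cond_pos d).
assert (key : forall t : R, (0 <= t < d)%R -> t <> 0%R -> y + t = phi x).
{ intros t Ht t0. destruct (Ceq_dec (y + t) (phi x)) as [e|e]; auto. exfalso.
  destruct (Hd x (y + t)) as [h1 h2].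
  - replace (x - x) with (RtoC 0) by ring. rewrite Cmod_0; auto.
  - replace (y + t - y) with (RtoC t) by ring. rewrite Cmod_R, Rabs_pos_eq; lra.
  - apply h2. assert (E := hz _ h1). simpl in E. 
    replace (H (x, y + t)) with (/ (y + t - phi x) * ((y + t - phi x) * H (x, y + t))) by (field; apply Cminus_neq; auto).
    rewrite E. ring. }
assert (k1 := key (d / 2)%R ltac:(lra) ltac:(lra)). assert (k2 := key (d / 3)%R ltac:(lra) ltac:(lra)).
rewrite <- k2 in k1. assert (k3 : RtoC (d / 2) = RtoC (d / 3)).
{ replace (RtoC (d / 2)) with (y + (d / 2)%R - y) by ring. rewrite k1. ring. }
apply RtoC_inj in k3. lra.
Qed.

(** No point of C is isolated. The base point is quantified inside the induction because it is moved
    away from the head of the list. *)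
Lemma locally_notin (l : list C) : forall (x0 : C) (P : C -> Prop),
  locally (T := C_UniformSpace) x0 P -> exists x, P x /\ ~ In x l.
Proof.
induction l as [|a l IH]; intros x0 P HP.
- exists x0. split; auto. apply (locally_singleton (T := C_UniformSpace)); auto.
- assert (Hx1 : exists x1, x1 <> a /\ locally (T := C_UniformSpace) x1 P).
  { destruct (Ceq_dec x0 a) as [e|e]; [|exists x0; auto].
    apply locally_locally in HP. apply locally_Cmod in HP. destruct HP as [d Hd].
    assert (d0 := cond_pos d).
    exists (x0 + (d / 2)%R). split.
    - subst a. intros E. assert (E1 : RtoC (d / 2) = 0) by (replace (RtoC (d / 2)) with (x0 + (d / 2)%R - x0) by ring; rewrite E; ring).
      apply RtoC_inj in E1. lra.
    - apply Hd. replace (x0 + (d / 2)%R - x0) with (RtoC (d / 2)) by ring. rewrite Cmod_R, Rabs_pos_eq; lra. }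
  destruct Hx1 as [x1 [n1 H1]].
  destruct (IH x1 (fun x => P x /\ x <> a)) as [x [[px nx] nl]].
  { apply filter_and; auto. apply (continuous_neq (U := C_UniformSpace) (fun x => x)); auto. ccont. }
  exists x. split; auto. intros [E|E]; auto.
Qed.

(** The restriction of [F] to the graph is continuous, and a non-zero value would persist at
    abscissas outside the finite list. The lists used below are the square and the cube roots of
    unity. *)
Lemma graph_vanish (D : C * C -> Prop) (F : C * C -> C) (phi : C -> C) (l : list C) :
  open2 D -> (forall p, D p -> cdiff2 F p) -> (forall p, D p -> cdiff phi (fst p)) ->
  (forall x, D (x, phi x) -> ~ In x l -> F (x, phi x) = 0) ->
  forall x, D (x, phi x) -> F (x, phi x) = 0.
Proof.
intros hD hF hphi hz x hx. destruct (Ceq_dec (F (x, phi x)) 0) as [e|n]; auto. exfalso.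
assert (cphi := cdiff_continuous _ _ (hphi _ hx)). simpl in cphi.
assert (cF := cdiff2_continuous _ _ (hF _ hx)).
assert (L := continuous_pair2 (U := C_UniformSpace) (fun t => t) phi _ x ltac:(ccont) cphi
  (filter_and _ _ (hD _ hx) (continuous_neq (U := C2) F _ (RtoC 0) cF n))).
destruct (locally_notin l x _ L) as [t [[h1 h2] h3]]. apply h2. apply hz; auto.
Qed.

(** * Graphs over the second coordinate *)

Definition swap (p : C * C) : C * C := (snd p, fst p).

Lemma cdiff2_swap (F : C * C -> C) p : cdiff2 F (swap p) -> cdiff2 (fun u => F (swap u)) p.
Proof. intros H. apply (cdiff2_comp2 F snd fst); auto. apply cdiff2_snd. apply cdiff2_fst. Qed.

Lemma open2_swap D : open2 D -> open2 (fun p => D (swap p)).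
Proof.
intros hD p hp. apply (continuous_pair2 (U := C2) snd fst D p). ccont. ccont. apply hD; auto.
Qed.

Lemma division_graph' (D : C * C -> Prop) (F : C * C -> C) (phi : C -> C) :
  open2 D -> (forall p, D p -> cdiff2 F p) -> (forall p, D p -> cdiff phi (snd p)) ->
  (forall y, D (phi y, y) -> F (phi y, y) = 0) ->
  exists Q, (forall p, D p -> cdiff2 Q p) /\ forall p, D p -> F p = (fst p - phi (snd p)) * Q p.
Proof.
intros hD hF hphi hz.
destruct (division_graph (fun p => D (swap p)) (fun p => F (swap p)) phi) as (Q & hQ & E).
- apply open2_swap; auto.
- intros p hp. apply cdiff2_swap; auto.
- intros p hp. apply (hphi (swap p)); auto.
- intros x. apply hz.
- assert (S : forall p, swap (swap p) = p) by (intros [x y]; reflexivity).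
  exists (fun p => Q (swap p)). split.
  + intros p hp. apply cdiff2_swap, hQ. rewrite S; auto.
  + intros p hp. rewrite <- (S p) at 1. apply (E (swap p)). rewrite S; auto.
Qed.

Lemma graph_cancel' (D : C * C -> Prop) (H : C * C -> C) (phi : C -> C) :
  open2 D -> (forall p, D p -> cdiff2 H p) ->
  (forall p, D p -> (fst p - phi (snd p)) * H p = 0) -> forall p, D p -> H p = 0.
Proof.
intros hD hH hz p hp.
assert (S : forall p, swap (swap p) = p) by (intros [x y]; reflexivity).
rewrite <- (S p). apply (graph_cancel (fun p => D (swap p)) (fun p => H (swap p)) phi).
- apply open2_swap; auto.
- intros q hq. apply cdiff2_swap; auto.
- intros q hq. apply (hz (swap q)); auto.
- rewrite S; auto.
Qed.

Lemma graph_vanish' (D : C * C -> Prop) (F : C * C -> C) (phi : C -> C) (l : list C) :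
  open2 D -> (forall p, D p -> cdiff2 F p) -> (forall p, D p -> cdiff phi (snd p)) ->
  (forall y, D (phi y, y) -> ~ In y l -> F (phi y, y) = 0) ->
  forall y, D (phi y, y) -> F (phi y, y) = 0.
Proof.
intros hD hF hphi hz y hy.
apply (graph_vanish (fun p => D (swap p)) (fun p => F (swap p)) phi l); auto.
- apply open2_swap; auto.
- intros q hq. apply cdiff2_swap; auto.
- intros p hp. apply (hphi (swap p)); auto.
Qed.

(** * The cyclic annulus *)

Lemma RtoC_2 : RtoC 2 = 1 + 1.
Proof. rewrite <- RtoC_plus. reflexivity. Qed.

Lemma two_neq_0 : (1 + 1 : C) <> 0.
Proof. rewrite <- RtoC_2. intros E. apply RtoC_inj in E. lra. Qed.

Section Annulus.
Variable K : R.
Notation D := (cyclic_annulus K).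

Lemma annulus_neq_0 w z : D (w, z) -> w <> 0 /\ z <> 0.
Proof.
intros (h1 & h2 & _). generalize (exp_pos (- K)); intros.
split; apply Cmod_gt_0; lra.
Qed.

Lemma annulus_swap w z : D (w, z) -> D (z, w).
Proof. intros (h1 & h2 & h3). repeat split; try tauto; rewrite Cmult_comm; tauto. Qed.

(** The moduli |w|, |z|, |wz| become |z|, 1/|wz|, 1/|w|, and the interval from exp (-K) to exp K is
    stable under inversion. *)
Lemma annulus_cyc w z : D (w, z) -> D (z, / (w * z)).
Proof.
intros h. destruct (annulus_neq_0 w z h) as [w0 z0]. destruct h as (h1 & h2 & h3).
assert (inv : forall u : C, u <> 0 -> (exp (- K) < Cmod u < exp K)%R -> (exp (- K) < Cmod (/ u) < exp K)%R).
{ intros u u0 [k1 k2]. rewrite Cmod_inv by auto. generalize (exp_pos K) (exp_pos (- K)). intros.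
  split.
  - rewrite exp_Ropp. apply Rinv_lt_contravar; auto. apply Rmult_lt_0_compat; lra.
  - replace (exp K) with (/ exp (- K))%R by (rewrite exp_Ropp, Rinv_inv; auto).
    apply Rinv_lt_contravar; auto. apply Rmult_lt_0_compat; lra. }
split; auto. split. apply inv; auto. apply Cmult_neq_0; auto.
replace (z * / (w * z)) with (/ w) by (field; auto). apply inv; auto.
Qed.

Lemma annulus_open : open2 D.
Proof.
assert (key : forall (f : C * C -> C) p, continuous (T := C2) (U := C_UniformSpace) f p ->
  (exp (- K) < Cmod (f p) < exp K)%R -> locally (T := C2) p (fun u => (exp (- K) < Cmod (f u) < exp K)%R)).
{ intros f p Hf [k1 k2].
  assert (d0 : (0 < Rmin (Cmod (f p) - exp (- K)) (exp K - Cmod (f p)))%R) by (apply Rmin_pos; lra).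
  generalize (proj1 (continuous_Cmod f p) Hf (mkposreal _ d0)). apply filter_imp. simpl. intros u Hu.
  assert (m1 := Rmin_l (Cmod (f p) - exp (- K)) (exp K - Cmod (f p))).
  assert (m2 := Rmin_r (Cmod (f p) - exp (- K)) (exp K - Cmod (f p))).
  assert (T1 := Cmod_triangle (f u - f p) (f p)). assert (T2 := Cmod_triangle (- (f u - f p)) (f u)).
  rewrite Cmod_opp in T2. replace (f u - f p + f p) with (f u) in T1 by ring.
  replace (- (f u - f p) + f u) with (f p) in T2 by ring. lra. }
intros [w z] (h1 & h2 & h3).
assert (k1 := key fst (w, z) ltac:(ccont) h1). assert (k2 := key snd (w, z) ltac:(ccont) h2).
assert (k3 := key (fun u => fst u * snd u) (w, z) ltac:(ccont) h3).
generalize (filter_and _ _ k1 (filter_and _ _ k2 k3)). apply filter_imp.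
intros [x y] (? & ? & ?). repeat split; tauto.
Qed.

Definition hol (f : C * C -> C) : Prop := forall p, D p -> cdiff2 f p.

Lemma holomorphic_on_hol f : holomorphic_on D f <-> hol f.
Proof. split; intros H p hp; apply ex_filterdiff_cdiff2; apply H; auto. Qed.

Lemma hol_mult f g : hol f -> hol g -> hol (fun p => f p * g p).
Proof. intros Hf Hg p hp. apply cdiff2_mult; auto. Qed.
Lemma hol_minus f g : hol f -> hol g -> hol (fun p => f p - g p).
Proof. intros Hf Hg p hp. apply cdiff2_minus; auto. Qed.
Lemma hol_plus f g : hol f -> hol g -> hol (fun p => f p + g p).
Proof. intros Hf Hg p hp. apply cdiff2_plus; auto. Qed.
Lemma hol_const c : hol (fun _ => c).
Proof. intros p hp. apply cdiff2_const; auto. Qed.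
Lemma hol_fst : hol fst.
Proof. intros p hp. apply cdiff2_fst; auto. Qed.
Lemma hol_snd : hol snd.
Proof. intros p hp. apply cdiff2_snd; auto. Qed.
Lemma hol_inv f : hol f -> (forall p, D p -> f p <> 0) -> hol (fun p => / f p).
Proof. intros Hf H0 p hp. apply cdiff2_inv; auto. Qed.
Lemma hol_comp f g h : hol f -> hol g -> hol h -> (forall p, D p -> D (g p, h p)) -> hol (fun p => f (g p, h p)).
Proof. intros Hf Hg Hh H p hp. apply (cdiff2_comp2 f g h); auto. Qed.

Lemma fst_neq_0 p : D p -> fst p <> 0.
Proof. destruct p as [w z]. apply annulus_neq_0. Qed.
Lemma snd_neq_0 p : D p -> snd p <> 0.
Proof. destruct p as [w z]. apply annulus_neq_0. Qed.

Lemma hol_swap f : hol f -> hol (fun p => f (snd p, fst p)).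
Proof.
intros Hf. apply hol_comp; auto using hol_fst, hol_snd. intros [w z]. apply annulus_swap.
Qed.

Lemma hol_inv_fst : hol (fun p => / fst p).
Proof. apply hol_inv. apply hol_fst. apply fst_neq_0. Qed.
Lemma hol_inv_snd : hol (fun p => / snd p).
Proof. apply hol_inv. apply hol_snd. apply snd_neq_0. Qed.

Lemma hol_rot f : hol f -> hol (fun p => f (snd p, / (fst p * snd p))).
Proof.
intros Hf. apply hol_comp; auto using hol_snd.
- apply hol_inv. apply hol_mult; auto using hol_fst, hol_snd.
  intros p hp. apply Cmult_neq_0; auto using fst_neq_0, snd_neq_0.
- intros [w z]. apply annulus_cyc.
Qed.

(** With c = 1/(ab) this is 1/(bc) = a, so a second rotation leads from (b, c) to (c, a). *)
Lemma rot3 (a b : C) : a <> 0 -> b <> 0 -> / (b * / (a * b)) = a.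
Proof. intros; field; auto. Qed.

Lemma Csqr_1 (a : C) : a * a = 1 -> a = 1 \/ a = - (1).
Proof.
intros E. destruct (Ceq_dec a 1) as [e|e]; auto. right.
assert (E2 : (a - 1) * (a + 1) = 0) by (transitivity (a * a - 1); [ring | rewrite E; ring]).
destruct (Ceq_dec (a + 1) 0) as [e2|e2].
- replace a with (a + 1 - 1) by ring. rewrite e2. ring.
- exfalso. exact (Cmult_neq_0 _ _ (Cminus_neq _ _ e) e2 E2).
Qed.

Lemma Cmult_integral (a b : C) : a * b = 0 -> a = 0 \/ b = 0.
Proof.
intros E. destruct (Ceq_dec a 0); auto. destruct (Ceq_dec b 0); auto.
exfalso. exact (Cmult_neq_0 _ _ n n0 E).
Qed.

(* A primitive cube root of unity: the three graphs of [vdm] meet where [a = b] and [a^3 = 1]. *)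
Definition omega : C := (- / 2, sqrt 3 / 2)%R.

Lemma omega_eq : omega * omega + omega + 1 = 0.
Proof.
assert (S := sqrt_sqrt 3 ltac:(lra)).
apply injective_projections; simpl; field_simplify; try rewrite <- Rsqr_pow2; unfold Rsqr; try rewrite S; field.
Qed.

Lemma Ccube_1 (a : C) : a * a * a = 1 -> In a (RtoC 1 :: omega :: (- (1) - omega) :: nil).
Proof.
intros E.
assert (E2 : (a - 1) * ((a - omega) * (a + 1 + omega)) = 0).
{ transitivity (a * a * a - 1 - (a - 1) * (omega * omega + omega + 1)). ring.
  rewrite E, omega_eq. ring. }
assert (Z : forall u v : C, u - v = 0 -> v = u).
{ intros u v H. replace u with (u - v + v) by ring. rewrite H. ring. }
apply Cmult_integral in E2. destruct E2 as [E2|E2]. left; auto.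
apply Cmult_integral in E2. destruct E2 as [E2|E2]. right; left; auto.
right; right; left. apply Z. rewrite <- E2. ring.
Qed.

Lemma Delta_neq_0 (a : C) : a <> 0 -> ~ In a (RtoC 1 :: (- (1)) :: nil) -> Delta_s a <> 0.
Proof.
intros a0 ha E. unfold Delta_s in E. rewrite RtoC_2 in E.
assert (E2 : a * a = 1).
{ transitivity ((1 + 1) * a * (/ (1 + 1) * (a - / a)) + 1). field. repeat split; auto using two_neq_0.
  rewrite E. ring. }
apply ha. destruct (Csqr_1 a E2); [left | right; left]; auto.
Qed.

Lemma Delta_inv (a : C) : a <> 0 -> Delta_s (/ a) = - Delta_s a.
Proof. intros a0. unfold Delta_s. replace (/ / a) with a by (field; auto). ring. Qed.

(** * Cancellation of the divisors on the annulus *)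

Lemma cancel_snd H phi : hol H -> (forall p, D p -> (snd p - phi (fst p)) * H p = 0) -> forall p, D p -> H p = 0.
Proof. apply (graph_cancel D). apply annulus_open. Qed.

Lemma cancel_fst H phi : hol H -> (forall p, D p -> (fst p - phi (snd p)) * H p = 0) -> forall p, D p -> H p = 0.
Proof. apply (graph_cancel' D). apply annulus_open. Qed.


(* The product of the equations of the three graphs [b = a], [a = 1/b^2] and [b = 1/a^2],
   on which two of the three cyclic variables coincide. *)
Definition vdm (p : C * C) : C :=
  (snd p - fst p) * ((fst p - / (snd p * snd p)) * (snd p - / (fst p * fst p))).

(** Rotation invariance is evident in this form; the factors of the definition, which differ from
    these by units, have the shape required for division along graphs. *)
Lemma vdm_eq (a b : C) : a <> 0 -> b <> 0 ->
  vdm (a, b) = (a - b) * (b - / (a * b)) * (/ (a * b) - a).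
Proof. intros. unfold vdm; simpl. field. auto. Qed.

Lemma hol_inv_sqr_fst : hol (fun p => / (fst p * fst p)).
Proof.
apply hol_inv. apply hol_mult; apply hol_fst. intros p hp. apply Cmult_neq_0; apply fst_neq_0; auto.
Qed.

Lemma hol_inv_sqr_snd : hol (fun p => / (snd p * snd p)).
Proof.
apply hol_inv. apply hol_mult; apply hol_snd. intros p hp. apply Cmult_neq_0; apply snd_neq_0; auto.
Qed.

Lemma vdm_cancel H : hol H -> (forall p, D p -> vdm p * H p = 0) -> forall p, D p -> H p = 0.
Proof.
intros hH hz.
apply (cancel_snd H (fun a => / (a * a))); auto.
apply (cancel_fst (fun p => (snd p - / (fst p * fst p)) * H p) (fun b => / (b * b))).
{ apply hol_mult; auto. apply hol_minus. apply hol_snd. apply hol_inv_sqr_fst. }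
apply (cancel_snd (fun p => (fst p - / (snd p * snd p)) * ((snd p - / (fst p * fst p)) * H p)) (fun a => a)).
{ repeat apply hol_mult; auto; apply hol_minus; auto using hol_fst, hol_snd, hol_inv_sqr_fst, hol_inv_sqr_snd. }
intros p hp. rewrite <- (hz p hp). unfold vdm. ring.
Qed.

(** Delta b = (b - 1) (b + 1) / (2 b) is a unit times the equations of two horizontal lines. *)
Lemma Delta_snd_cancel H : hol H -> (forall p, D p -> Delta_s (snd p) * H p = 0) -> forall p, D p -> H p = 0.
Proof.
intros hH hz.
apply (cancel_snd H (fun _ => 1)); auto.
apply (cancel_snd (fun p => (snd p - 1) * H p) (fun _ => - (1))).
{ apply hol_mult; auto. apply hol_minus; auto using hol_snd, hol_const. }
intros p hp. assert (n := snd_neq_0 p hp).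
transitivity ((1 + 1) * snd p * (Delta_s (snd p) * H p)).
{ unfold Delta_s. rewrite RtoC_2. field. repeat split; auto using two_neq_0. }
rewrite hz by auto. ring.
Qed.

Lemma Delta_fst_cancel H : hol H -> (forall p, D p -> Delta_s (fst p) * H p = 0) -> forall p, D p -> H p = 0.
Proof.
intros hH hz [a b] hp.
change (H (a, b)) with ((fun p => H (snd p, fst p)) (b, a)).
apply (Delta_snd_cancel (fun p => H (snd p, fst p))); [apply (hol_swap H); auto | | apply annulus_swap; auto].
intros [x y] h. apply (hz (y, x)). apply annulus_swap; auto.
Qed.

Lemma Delta_rot_cancel H : hol H -> (forall p, D p -> Delta_s (/ (fst p * snd p)) * H p = 0) ->
  forall p, D p -> H p = 0.
Proof.
intros hH hz [a b] hp. destruct (annulus_neq_0 a b hp) as [a0 b0].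
set (c := / (a * b)). assert (hc := annulus_cyc a b hp). fold c in hc.
assert (hc2 := annulus_cyc _ _ hc). replace (/ (b * c)) with a in hc2 by (unfold c; field; auto).
(* At (c, a) the rotated function takes the value H (a, b), and the first coordinate is c. *)
replace (H (a, b)) with ((fun p => H (snd p, / (fst p * snd p))) (c, a)).
2:{ simpl. f_equal. f_equal. unfold c. field. auto. }
apply (Delta_fst_cancel (fun p => H (snd p, / (fst p * snd p)))); [apply (hol_rot H); auto | | auto].
intros [x y] h. destruct (annulus_neq_0 x y h). assert (h2 := hz _ (annulus_cyc x y h)). simpl in *.
rewrite rot3 in h2; auto.
Qed.

(** The left side is the entry belonging to Delta b of the cross product of the two solution
    vectors. *)
Lemma cross_division m n : M_plus Delta_s K m -> M_plus Delta_s K n ->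
  exists r, H_plus_cyc K r /\ forall a b, D (a, b) ->
    m (a, b) * n (b, / (a * b)) - m (b, / (a * b)) * n (a, b) = r (a, b) * vdm (a, b) * Delta_s b.
Proof.
intros [[hm sm] cm] [[hn sn] cn]. apply holomorphic_on_hol in hm. apply holomorphic_on_hol in hn.
set (N := fun p => m p * n (snd p, / (fst p * snd p)) - m (snd p, / (fst p * snd p)) * n p).
assert (hN : hol N) by (apply hol_minus; apply hol_mult; auto using hol_rot).
(* Eliminating the terms with Delta a from the two CLRs shows that neighbouring entries are in the
   ratio of the Deltas. *)
assert (relN : forall a b, D (a, b) -> Delta_s (/ (a * b)) * N (a, b) = Delta_s b * N (b, / (a * b))).
{ intros a b h. destruct (annulus_neq_0 a b h) as [a0 b0]. unfold N; simpl. rewrite rot3 by auto.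
  assert (E1 := cm a b h). assert (E2 := cn a b h). set (c := / (a * b)) in *.
  transitivity (n (b, c) * (m (a, b) * Delta_s c + m (b, c) * Delta_s a + m (c, a) * Delta_s b)
   - m (b, c) * (n (a, b) * Delta_s c + n (b, c) * Delta_s a + n (c, a) * Delta_s b)
   + Delta_s b * (m (b, c) * n (c, a) - m (c, a) * n (b, c))). ring.
  rewrite E1, E2. ring. }
(* On b = e the right side of [relN] is 0, while Delta c = Delta (e / a) = - e Delta a vanishes only
   at a = 1 and a = -1. *)
assert (N0 : forall e, e * e = 1 -> forall a, D (a, e) -> N (a, e) = 0).
{ intros e ee. apply (graph_vanish D N (fun _ => e) (RtoC 1 :: (- (1)) :: nil)); auto using annulus_open.
  - intros; apply cdiff_const.
  - intros a h ha. destruct (annulus_neq_0 a e h) as [a0 e0].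
    assert (E := relN a e h).
    assert (De : Delta_s e = 0). { unfold Delta_s. replace (/ e) with e. ring. transitivity (e * e * / e). field; auto. rewrite ee. ring. }
    rewrite De, Cmult_0_l in E. apply Cmult_integral in E. destruct E as [E|E]; auto. exfalso.
    assert (Ei : / (a * e) = e * / a) by (transitivity (e * e * / (a * e)); [rewrite ee; ring | field; auto]).
    rewrite Ei in E. assert (Ed : Delta_s (e * / a) = e * Delta_s (/ a)).
    { unfold Delta_s. replace (/ (e * / a)) with (e * e * / (e * / a)) by (rewrite ee; ring). field_simplify_eq; [ring [ee]|]; auto. }
    rewrite Ed, Delta_inv in E by auto. apply Cmult_integral in E. destruct E as [E|E]; auto.
    apply (Delta_neq_0 a a0 ha). replace (Delta_s a) with (- - Delta_s a) by ring. rewrite E. ring. }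
destruct (division_graph D N (fun _ => 1)) as (N1 & hN1 & EN1); auto using annulus_open.
{ intros; apply cdiff_const. } { intros x; apply N0. ring. }
destruct (division_graph D N1 (fun _ => - (1))) as (N2 & hN2 & EN2); auto using annulus_open.
{ intros; apply cdiff_const. }
{ intros x h. assert (E := EN1 _ h). simpl in E. rewrite N0 in E; auto. 2: ring.
  symmetry in E. apply Cmult_integral in E. destruct E as [E|E]; auto. exfalso. apply two_neq_0.
  replace (1 + 1) with (- (- (1) - 1)) by ring. rewrite E. ring. }
(* The factor 2 b turns the divisor (b - 1) (b + 1) into Delta b. *)
set (G := fun p => (1 + 1) * snd p * N2 p).
assert (hG : hol G) by (repeat apply hol_mult; auto using hol_snd, hol_const).
assert (EG : forall a b, D (a, b) -> N (a, b) = G (a, b) * Delta_s b).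
{ intros a b h. destruct (annulus_neq_0 a b h) as [a0 b0]. rewrite EN1, EN2 by auto. unfold G, Delta_s; simpl.
  rewrite RtoC_2. field. repeat split; auto using two_neq_0. }
clearbody G. clear N1 hN1 EN1 N2 hN2 EN2.
(* Insert N = G Delta into [relN] and cancel Delta b and Delta c. *)
assert (cG : forall a b, D (a, b) -> G (b, / (a * b)) = G (a, b)).
{ intros a b h. 
  enough (E : (fun p => G (snd p, / (fst p * snd p)) - G p) (a, b) = 0).
  { simpl in E. replace (G (a, b)) with (G (b, / (a * b)) - (G (b, / (a * b)) - G (a, b))) by ring. rewrite E. ring. }
  assert (hH : hol (fun p => G (snd p, / (fst p * snd p)) - G p)) by (apply hol_minus; auto using hol_rot).
  revert h. apply (Delta_snd_cancel (fun p => G (snd p, / (fst p * snd p)) - G p)); auto.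
  apply (Delta_rot_cancel (fun p => Delta_s (snd p) * (G (snd p, / (fst p * snd p)) - G p))).
  { apply hol_mult; auto. unfold Delta_s. repeat apply hol_mult; auto using hol_const.
    apply hol_minus; auto using hol_snd, hol_inv_snd. }
  intros [x y] h. simpl. assert (E := relN x y h). rewrite (EG x y h), (EG _ _ (annulus_cyc x y h)) in E.
  transitivity (Delta_s y * (G (y, / (x * y)) * Delta_s (/ (x * y))) - Delta_s (/ (x * y)) * (G (x, y) * Delta_s y)).
  ring. rewrite E. ring. }
assert (cG2 : forall a b, D (a, b) -> G (/ (a * b), a) = G (a, b)).
{ intros a b h. destruct (annulus_neq_0 a b h) as [a0 b0].
  rewrite <- (cG a b h), <- (cG _ _ (annulus_cyc a b h)), rot3; auto. }
(* By symmetry of [m] and [n], N (b, a) + N (c, a) = 0. Both terms carry the factor Delta a, and G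
   (c, a) = G (a, b). *)
assert (aG : forall a b, D (a, b) -> G (b, a) = - G (a, b)).
{ intros a b h.
  enough (E : (fun p => G (snd p, fst p) + G p) (a, b) = 0).
  { simpl in E. replace (G (b, a)) with (G (b, a) + G (a, b) - G (a, b)) by ring. rewrite E. ring. }
  revert h. apply (Delta_fst_cancel (fun p => G (snd p, fst p) + G p)). apply hol_plus; auto. apply (hol_swap G); auto.
  intros [x y] h. simpl. destruct (annulus_neq_0 x y h) as [x0 y0].
  assert (h1 := annulus_cyc x y h). assert (h2 := annulus_cyc _ _ h1). rewrite rot3 in h2 by auto.
  assert (h' := annulus_swap x y h).
  transitivity (G (y, x) * Delta_s x + G (/ (x * y), x) * Delta_s x). rewrite cG2 by auto; ring.
  rewrite <- !EG by auto. unfold N; simpl. rewrite (Cmult_comm y x).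
  replace (/ (/ (x * y) * x)) with y by (field; auto).
  rewrite (sm y x h'), (sn y x h'), (sm x _ (annulus_swap _ _ h2)), (sn x _ (annulus_swap _ _ h2)). ring. }
assert (dG : forall a, D (a, a) -> G (a, a) = 0).
{ intros a h. assert (E := aG a a h).
  assert (E2 : (1 + 1) * G (a, a) = 0). { transitivity (G (a, a) + G (a, a)). ring. rewrite E at 1. ring. }
  apply Cmult_integral in E2. destruct E2 as [E2|]; auto. destruct (two_neq_0 E2). }
destruct (division_graph D G (fun a => a)) as (G1 & hG1 & EG1); auto using annulus_open.
{ intros; apply cdiff_id. }
assert (dinv : forall a : C, a <> 0 -> cdiff (fun a => / (a * a)) a).
{ intros a a0. apply (cdiff_inv (fun a => a * a)). apply (cdiff_mult (fun a => a) (fun a => a)); apply cdiff_id. apply Cmult_neq_0; auto. }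
assert (cube : forall b : C, b <> 0 -> / (b * b) = b -> b * b * b = 1).
{ intros b b0 E. transitivity (b * b * / (b * b)). rewrite E. reflexivity. field; auto. }
assert (Z : forall u v : C, u - v = 0 -> v = u).
{ intros u v H. replace u with (u - v + v) by ring. rewrite H. ring. }
(* On a = 1/b^2 one has c = b, so a rotation moves the point to the diagonal; [gl2] uses two
   rotations on b = 1/a^2. *)
assert (gl1 : forall b, D (/ (b * b), b) -> G (/ (b * b), b) = 0).
{ intros b h. destruct (annulus_neq_0 _ _ h) as [_ b0]. assert (h2 := annulus_cyc _ _ h).
  rewrite <- cG by auto. replace (/ (/ (b * b) * b)) with b in * by (field; auto). apply dG; auto. }
assert (gl2 : forall a, D (a, / (a * a)) -> G (a, / (a * a)) = 0).
{ intros a h. destruct (annulus_neq_0 _ _ h) as [a0 _]. assert (h2 := annulus_cyc _ _ (annulus_cyc _ _ h)).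
  rewrite <- cG2 by auto. assert (i0 := snd_neq_0 _ h). simpl in i0. rewrite (rot3 a _ a0 i0) in h2.
  replace (/ (a * / (a * a))) with a in * by (field; auto). apply dG; auto. }
destruct (division_graph' D G1 (fun b => / (b * b))) as (G2 & hG2 & EG2); auto using annulus_open.
{ intros p hp. apply dinv, snd_neq_0; auto. }
(* The factor b - a already divided out vanishes on this graph only where b^3 = 1. *)
{ apply (graph_vanish' D G1 (fun b => / (b * b)) (RtoC 1 :: omega :: (- (1) - omega) :: nil)); auto using annulus_open.
  { intros p hp. apply dinv, snd_neq_0; auto. }
  intros b h nb. assert (b0 := snd_neq_0 _ h). simpl in b0. assert (E := EG1 _ h). rewrite gl1 in E by auto. simpl in E.
  symmetry in E. apply Cmult_integral in E. destruct E as [E|E]; auto. exfalso. apply nb. apply Ccube_1.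
  apply cube; auto. }
destruct (division_graph D G2 (fun a => / (a * a))) as (r & hr & Er); auto using annulus_open.
{ intros p hp. apply dinv, fst_neq_0; auto. }
(* On b = 1/a^2 both earlier factors, 1/a^2 - a and a - a^4, vanish only where a^3 = 1. *)
{ apply (graph_vanish D G2 (fun a => / (a * a)) (RtoC 1 :: omega :: (- (1) - omega) :: nil)); auto using annulus_open.
  { intros p hp. apply dinv, fst_neq_0; auto. }
  intros a h na. assert (a0 := fst_neq_0 _ h). simpl in a0. assert (E := EG1 _ h). rewrite gl2, EG2 in E by auto. simpl in E.
  symmetry in E. apply Cmult_integral in E. destruct E as [E|E].
  { exfalso. apply na, Ccube_1, cube; auto. symmetry. apply Z, E. }
  apply Cmult_integral in E. destruct E as [E|E]; auto. exfalso. apply na, Ccube_1.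
  transitivity (1 - / a * (a - / (/ (a * a) * / (a * a)))). field; auto. rewrite E; ring. }
assert (Gr : forall p, D p -> G p = vdm p * r p).
{ intros p hp. rewrite EG1, EG2, Er by auto. unfold vdm. ring. }
exists r. split; [split; [split|]|].
- apply holomorphic_on_hol. auto.
(* [G] and [vdm] are both antisymmetric and both cyclic invariant; cancelling [vdm] makes the
   quotient symmetric and cyclic invariant. *)
- intros a b h.
  enough (E : (fun p => r p - r (snd p, fst p)) (a, b) = 0).
  { simpl in E. apply Z in E. auto. }
  revert h. apply (vdm_cancel (fun p => r p - r (snd p, fst p))). apply hol_minus; auto. apply (hol_swap r); auto.
  intros [x y] h. simpl. assert (h' := annulus_swap _ _ h). assert (E := aG x y h). rewrite !Gr in E by auto.
  assert (V : vdm (y, x) = - vdm (x, y)) by (unfold vdm; simpl; ring). rewrite V in E.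
  transitivity (vdm (x, y) * r (x, y) + (- vdm (x, y) * r (y, x))). ring. rewrite E. ring.
- intros a b h.
  enough (E : (fun p => r p - r (snd p, / (fst p * snd p))) (a, b) = 0).
  { simpl in E. apply Z in E. auto. }
  revert h. apply (vdm_cancel (fun p => r p - r (snd p, / (fst p * snd p)))). apply hol_minus; auto. apply (hol_rot r); auto.
  intros [x y] h. simpl. destruct (annulus_neq_0 x y h) as [x0 y0].
  assert (h' := annulus_cyc _ _ h). assert (E := cG x y h). rewrite !Gr in E by auto.
  assert (V : vdm (y, / (x * y)) = vdm (x, y)).
  { rewrite !vdm_eq, rot3; auto. ring. apply (annulus_neq_0 _ _ h'). }
  rewrite V in E. transitivity (vdm (x, y) * r (x, y) - vdm (x, y) * r (y, / (x * y))). ring. rewrite E. ring.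
- intros a b h. assert (E := EG a b h). rewrite Gr in E by auto. unfold N in E; simpl in E. rewrite E. ring.
Qed.

End Annulus.

(** * The two basis solutions *)

Section Basis.
Variable K : R.
Notation D := (cyclic_annulus K).

Lemma hol_ext f g : (forall p, f p = g p) -> hol K f -> hol K g.
Proof.
intros E Hf p hp. apply (cdiff2_ext_loc f); auto. apply (filter_forall (F := locally (T := C2) p)). auto.
Qed.

Lemma hol_basis_B1 : hol K basis_B1.
Proof.
apply (hol_ext (fun p => fst p + snd p + / fst p + / snd p + 2)).
{ intros [w z]; reflexivity. }
repeat apply hol_plus; auto using hol_fst, hol_snd, hol_inv_fst, hol_inv_snd, hol_const.
Qed.

Lemma hol_basis_B2 : hol K basis_B2.
Proof.
apply (hol_ext (fun p => 2 * (fst p * snd p) + 2 * / (fst p * snd p) + fst p * / snd p + snd p * / fst p)).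
{ intros [w z]; reflexivity. }
repeat apply hol_plus; repeat apply hol_mult; auto using hol_fst, hol_snd, hol_inv_fst, hol_inv_snd, hol_const.
apply hol_inv. apply hol_mult; auto using hol_fst, hol_snd.
intros p hp. apply Cmult_neq_0; eauto using fst_neq_0, snd_neq_0.
Qed.

Lemma M_plus_basis_B1 : M_plus Delta_s K basis_B1.
Proof.
split; [split|].
- apply holomorphic_on_hol, hol_basis_B1.
- intros w z _. unfold basis_B1. ring.
- intros w z h. destruct (annulus_neq_0 K w z h). unfold basis_B1, Delta_s. rewrite RtoC_2.
  field. repeat split; auto using two_neq_0.
Qed.

Lemma M_plus_basis_B2 : M_plus Delta_s K basis_B2.
Proof.
split; [split|].
- apply holomorphic_on_hol, hol_basis_B2.
- intros w z _. unfold basis_B2. rewrite (Cmult_comm z w). ring.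
- intros w z h. destruct (annulus_neq_0 K w z h). unfold basis_B2, Delta_s. rewrite RtoC_2.
  field. repeat split; auto using two_neq_0.
Qed.

(** By [cross_division] every pair of solutions has the factor vdm * Delta b; here the cofactor is
    an invertible constant, so that Cramer's rule produces no poles. *)
Lemma basis_cross (a b : C) : a <> 0 -> b <> 0 ->
  basis_B1 (a, b) * basis_B2 (b, / (a * b)) - basis_B1 (b, / (a * b)) * basis_B2 (a, b)
  = (1 + 1) * vdm (a, b) * Delta_s b.
Proof.
intros a0 b0. rewrite vdm_eq by auto. unfold basis_B1, basis_B2, Delta_s. rewrite RtoC_2.
field. repeat split; auto using two_neq_0.
Qed.

Lemma vdm_Delta_cancel H : hol K H -> (forall p, D p -> vdm p * Delta_s (snd p) * H p = 0) ->
  forall p, D p -> H p = 0.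
Proof.
intros hH hz. apply (Delta_snd_cancel K H); auto.
apply (vdm_cancel K (fun p => Delta_s (snd p) * H p)).
- apply hol_mult; auto. unfold Delta_s. apply hol_mult. apply hol_const.
  apply hol_minus; auto using hol_snd, hol_inv_snd.
- intros p hp. rewrite <- (hz p hp). ring.
Qed.

Lemma H_plus_cyc_scal c r : H_plus_cyc K r -> H_plus_cyc K (fun p => c * r p).
Proof.
intros [[hr sr] cr]. split; [split|].
- apply holomorphic_on_hol, hol_mult. apply hol_const. apply holomorphic_on_hol; auto.
- intros w z h. rewrite sr; auto.
- intros w z h. rewrite cr; auto.
Qed.

End Basis.

Theorem theoremA (K : R) (hK : (0 < K)%R)
    (M : C * C -> C) (hM : M_plus Delta_s K M) :
  exists f1 f2 : C * C -> C,
    (H_plus_cyc K f1 /\ H_plus_cyc K f2 /\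
     eq_on (cyclic_annulus K) M (fun p : C * C => f1 p * basis_B1 p + f2 p * basis_B2 p)) /\
    (forall g1 g2 : C * C -> C,
       H_plus_cyc K g1 -> H_plus_cyc K g2 ->
       eq_on (cyclic_annulus K) M (fun p : C * C => g1 p * basis_B1 p + g2 p * basis_B2 p) ->
       eq_on (cyclic_annulus K) g1 f1 /\ eq_on (cyclic_annulus K) g2 f2).
Proof.
destruct (cross_division K M basis_B2 hM (M_plus_basis_B2 K)) as (r1 & h1 & E1).
destruct (cross_division K basis_B1 M (M_plus_basis_B1 K) hM) as (r2 & h2 & E2).
assert (tw := two_neq_0).
assert (hMh : hol K M) by (apply holomorphic_on_hol, hM).
(* Existence and uniqueness both end in an identity that holds after multiplication by vdm * Delta
   b; the factor 1/2 inverts the constant of [basis_cross]. *)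
assert (sep : forall F G : C * C -> C, hol K F -> hol K G ->
  (forall a b, cyclic_annulus K (a, b) -> vdm (a, b) * Delta_s b * (F (a, b) - / (1 + 1) * G (a, b)) = 0) ->
  eq_on (cyclic_annulus K) F (fun p => / (1 + 1) * G p)).
{ intros F G hF hG hz p hp.
  assert (E := vdm_Delta_cancel K (fun p => F p - / (1 + 1) * G p)
    (hol_minus K _ _ hF (hol_mult K _ _ (hol_const K _) hG)) (fun '(a, b) h => hz a b h) p hp).
  simpl in E. replace (F p) with (F p - / (1 + 1) * G p + / (1 + 1) * G p) by ring. rewrite E. ring. }
assert (hr1 : hol K r1) by (apply holomorphic_on_hol, h1).
assert (hr2 : hol K r2) by (apply holomorphic_on_hol, h2).
exists (fun p => / (1 + 1) * r1 p), (fun p => / (1 + 1) * r2 p). split; [split; [|split]|].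
- apply H_plus_cyc_scal; auto.
- apply H_plus_cyc_scal; auto.
- intros p hp.
  rewrite (sep M (fun p => r1 p * basis_B1 p + r2 p * basis_B2 p)); auto.
  { ring. }
  { apply hol_plus; apply hol_mult; auto using hol_basis_B1, hol_basis_B2. }
  clear p hp. intros a b h. destruct (annulus_neq_0 K a b h) as [a0 b0].
  assert (X := basis_cross a b a0 b0). assert (X1 := E1 a b h). assert (X2 := E2 a b h).
  (* With primes for values at (b, c), this is (B1 B2' - B1' B2) M = (M B2' - M' B2) B1 + (B1 M' -
     B1' M) B2. *)
  transitivity (/ (1 + 1) * ((1 + 1) * vdm (a, b) * Delta_s b * M (a, b)
    - basis_B1 (a, b) * (r1 (a, b) * vdm (a, b) * Delta_s b)
    - basis_B2 (a, b) * (r2 (a, b) * vdm (a, b) * Delta_s b))).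
  { field; auto. }
  rewrite <- X, <- X1, <- X2. ring.
- intros g1 g2 [[hg1 _] cg1] [[hg2 _] cg2] Eg.
  apply holomorphic_on_hol in hg1. apply holomorphic_on_hol in hg2.
  (* Cyclic invariance gives [g1] and [g2] the same values at (b, c) as at (a, b), so they factor
     out of the cross products: that of M and B2 is g1 times that of B1 and B2, and that of B1 and M
     is g2 times it. *)
  split; apply sep; auto; intros a b h; destruct (annulus_neq_0 K a b h) as [a0 b0];
  assert (X := basis_cross a b a0 b0); assert (X1 := E1 a b h); assert (X2 := E2 a b h);
  rewrite (Eg _ h), (Eg _ (annulus_cyc K a b h)), <- cg1, <- cg2 in X1, X2 by auto.
  + transitivity (/ (1 + 1) * (g1 (a, b) * ((1 + 1) * vdm (a, b) * Delta_s b) - r1 (a, b) * vdm (a, b) * Delta_s b)).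
    { field; auto. } rewrite <- X, <- X1. ring.
  + transitivity (/ (1 + 1) * (g2 (a, b) * ((1 + 1) * vdm (a, b) * Delta_s b) - r2 (a, b) * vdm (a, b) * Delta_s b)).
    { field; auto. } rewrite <- X, <- X2. ring.
Qed.
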